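(* For every $\alpha\in[0,1)$, $$\widetilde{\mathrm{CMO}}_\alpha(\mathbb R^n)=\mathrm{CMO}_\alpha(\mathbb R^n).$$ For $\alpha=1$, $\mathrm{CMO}_1(\mathbb R^n)\subsetneqq\widetilde{\mathrm{CMO}}_1(\mathbb R^n)$; in fact, $\mathrm{CMO}_1(\mathbb R^n)$ is exactly the space of (a.e.) constant functions, identified with $\mathbb C$.
   Context: Functions are complex-valued on $\mathbb R^n$. Cubes $Q\subset\mathbb R^n$ are closed with sides parallel to the coordinate axes, and $f_Q:=\frac1{|Q|}\int_Qf$. Let $\alpha\in[0,1]$. $\mathcal O_\alpha(f;Q):=\frac{1}{|Q|^{1+\alpha/n}}\int_Q|f(x)-f_Q|\,dx$. $\mathrm{BMO}_\alpha(\mathbb R^n)$ is the space of all $f\in L^1_{loc}(\mathbb R^n)$ with $\|f\|_{\mathrm{BMO}_\alpha(\mathbb R^n)}:=\sup_Q\mathcal O_\alpha(f;Q)<\infty$. $\widetilde{\mathrm{CMO}}_\alpha(\mathbb R^n)$ is the closure of $C_c^\infty(\mathbb R^n)$ in $\mathrm{BMO}_\alpha(\mathbb R^n)$, i.e. all $f\in\mathrm{BMO}_\alpha(\mathbb R^n)$ such that for each $\epsilon>0$ there is $g\in C_c^\infty(\mathbb R^n)$ with $\|f-g\|_{\mathrm{BMO}_\alpha(\mathbb R^n)}<\epsilon$. $\mathrm{CMO}_\alpha(\mathbb R^n)$ is the set of all $f\in\mathrm{BMO}_\alpha(\mathbb R^n)$ satisfying the three conditions (1) $\lim_{r\to0}\sup_{|Q|=r}\mathcal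 O_\alpha(f;Q)=0$; (2) $\lim_{r\to\infty}\sup_{|Q|=r}\mathcal O_\alpha(f;Q)=0$; (3) $\lim_{d\to\infty}\sup_{Q\cap[-d,d]^n=\emptyset}\mathcal O_\alpha(f;Q)=0$. *)

(* Defs.v *)
From HB Require Import structures.
From mathcomp Require Import all_boot all_order all_algebra.
From mathcomp Require Import complex.
From mathcomp Require Import all_classical all_reals all_analysis.

Set Implicit Arguments.
Unset Strict Implicit.
Unset Printing Implicit Defensive.

Import Order.TTheory GRing.Theory Num.Theory.
Import numFieldNormedType.Exports.

Local Open Scope classical_set_scope.
Local Open Scope ring_scope.

Fact rV_display : measure_display. Proof. exact: default_measure_display. Qed.

(* The Borel sigma-algebra of R^n, as the product sigma-algebra. *)
Section rV_measurable.
Variables (R : realType) (n : nat).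

Definition rV_coord (i : 'I_n) (x : 'rV[R]_n) : measurableTypeR R := x ord0 i.

Let rV_set0 : g_sigma_preimage rV_coord set0.
Proof. exact: sigma_algebra0. Qed.

Let rV_setC A : g_sigma_preimage rV_coord A -> g_sigma_preimage rV_coord (~` A).
Proof. exact: sigma_algebraC. Qed.

Let rV_bigcup (F : (set 'rV[R]_n)^nat) :
  (forall i, g_sigma_preimage rV_coord (F i)) ->
  g_sigma_preimage rV_coord (\bigcup_i (F i)).
Proof. exact: sigma_algebra_bigcup. Qed.

HB.instance Definition _ := @isMeasurable.Build rV_display
  'rV[R]_n (g_sigma_preimage rV_coord) rV_set0 rV_setC rV_bigcup.

End rV_measurable.

Lemma measurable_rV_coord (R : realType) n (i : 'I_n) :
  measurable_fun [set: 'rV[R]_n] (rV_coord i).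
Proof.
move=> _ Y mY; rewrite setTI; apply: sub_sigma_algebra => /=.
rewrite -bigcup_seq/=; exists i => /=; first by rewrite mem_index_enum.
by exists Y => //; rewrite setTI.
Qed.

Lemma measurable_fun_rV (R : realType) n d (T : measurableType d)
    (f : T -> 'rV[R]_n) :
  (forall i, measurable_fun [set: T] (rV_coord i \o f)) ->
  measurable_fun [set: T] f.
Proof.
move=> mf.
have prefS : g_sigma_preimage (fun i => rV_coord i \o f) `<=` measurable.
  apply: smallest_sub; first exact: sigma_algebra_measurable.
  move=> A; rewrite -bigcup_seq => -[i _ [B mB <-]].
  exact: mf.
move: prefS; rewrite (g_sigma_preimage_comp (fun i => @rV_coord R n i)) => prefS.
by move=> _ A mA; apply: prefS; exists A.
Qed.

Definition rV_cons (R : realType) n (p : measurableTypeR R * 'rV[R]_n) :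
  'rV[R]_n.+1 := row_mx (const_mx p.1 : 'M[R]_1) p.2.

Lemma measurable_rV_cons (R : realType) n :
  measurable_fun [set: measurableTypeR R * 'rV[R]_n] (@rV_cons R n).
Proof.
apply: measurable_fun_rV => i; case: (split_ordP (i : 'I_(1 + n))) => j ->.
- rewrite (_ : _ \o _ = fst); first exact: measurable_fst.
  apply/funext => p; rewrite /= /rV_coord /rV_cons.
  by apply: etrans (row_mxEl _ _ _ _) _; rewrite mxE.
- rewrite (_ : _ \o _ = rV_coord j \o snd).
    exact: measurableT_comp (measurable_rV_coord _) _.
  apply/funext => p; rewrite /= /rV_coord /rV_cons.
  exact: row_mxEr.
Qed.

Section rV_cons_pushforward.
Variables (R : realType) (n : nat).
Variable mu : {sigma_finite_measure set 'rV[R]_n -> \bar R}.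

Definition rV_cons_measure : set 'rV[R]_n.+1 -> \bar R :=
  pushforward (@lebesgue_measure R \x mu)%E (@rV_cons R n).

Let m0 : rV_cons_measure set0 = 0%E.
Proof. by rewrite /rV_cons_measure /pushforward preimage_set0 measure0. Qed.

Let m_ge0 A : (0 <= rV_cons_measure A)%E.
Proof. by rewrite /rV_cons_measure /pushforward measure_ge0. Qed.

Let m_sigma_additive : semi_sigma_additive rV_cons_measure.
Proof.
have mpre (A : set 'rV[R]_n.+1) :
    measurable A -> measurable (@rV_cons R n @^-1` A).
  by move=> mA; rewrite -[X in measurable X]setTI; exact: measurable_rV_cons.
move=> F mF tF mUF; rewrite /rV_cons_measure /pushforward preimage_bigcup.
apply: measure_semi_sigma_additive.
- by move=> k; exact: mpre.
- apply/trivIsetP => i j _ _ ij; rewrite -preimage_setI.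
  by move/trivIsetP : tF => /(_ _ _ _ _ ij) ->//; rewrite preimage_set0.
- by rewrite -preimage_bigcup; exact: mpre.
Qed.

HB.instance Definition _ := isMeasure.Build _ _ _ rV_cons_measure
  m0 m_ge0 m_sigma_additive.

Let rV_cons_sigma_finite : sigma_finite setT rV_cons_measure.
Proof.
have /sigma_finiteP[F [TF ndF Foo]] := sigma_finiteT (@lebesgue_measure R).
have /sigma_finiteP[G [TG ndG Goo]] := sigma_finiteT mu.
pose g (x : 'rV[R]_n.+1) : measurableTypeR R * 'rV[R]_n :=
  (x ord0 ord0, rsubmx (x : 'rV_(1 + n))).
have gK : cancel (@rV_cons R n) g.
  move=> [a v]; rewrite /g /rV_cons row_mxKr /=; congr pair.
  have -> : ord0 = lshift n (ord0 : 'I_1) by apply/val_inj.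
  by apply: etrans (row_mxEl _ _ _ _) _; rewrite mxE.
have mg : measurable_fun setT g.
  apply/measurable_fun_pairP; split.
    exact: (@measurable_rV_coord R n.+1 ord0).
  apply: measurable_fun_rV => i.
  rewrite (_ : _ \o _ = rV_coord (rshift 1 i : 'I_n.+1)).
    exact: measurable_rV_coord.
  by apply/funext => x /=; rewrite /rV_coord mxE.
exists (fun k => g @^-1` (F k `*` G k)).
  rewrite -preimage_bigcup -(preimage_setT g) -setXTT TF TG; congr (_ @^-1` _).
  rewrite predeqE => -[x y]; split => [/= [[k _ Fkx] [l _ Gly]]|].
    exists (maxn k l) => //; split.
    - by move: x Fkx; exact/subsetPset/ndF/leq_maxl.
    - by move: y Gly; exact/subsetPset/ndG/leq_maxr.
  by move=> [k _ []/= ? ?]; split; exists k.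
move=> k; have [mFk Fk] := Foo k; have [mGk Gk] := Goo k; split.
  by rewrite -[X in measurable X]setTI; apply: mg => //; exact: measurableX.
rewrite /rV_cons_measure /pushforward -comp_preimage.
rewrite (_ : g \o _ = id); last by apply/funext => x /=; rewrite gK.
by rewrite preimage_id product_measure1E// lte_mul_pinfty// ge0_fin_numE.
Qed.

HB.instance Definition _ := Measure_isSigmaFinite.Build _ _ _
  rV_cons_measure rV_cons_sigma_finite.

End rV_cons_pushforward.

(* The n-fold product of the one-dimensional Lebesgue measure. *)
Fixpoint borel_lebesgue (R : realType) n :
    {sigma_finite_measure set 'rV[R]_n -> \bar R} :=
  match n with
  | 0 => \d_(0 : 'rV[R]_0)
  | n'.+1 => rV_cons_measure (borel_lebesgue R n')
  end.

(* R^n with the Lebesgue-measurable sets, i.e. the sets that are Caratheodory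
   measurable for the outer measure generated by the Borel product measure;
   lebesgue_rV is thus complete, and locally integrable functions below are
   Lebesgue measurable rather than Borel. *)
Notation rVleb R n := (caratheodory_type (mu_ext (borel_lebesgue R n))).

Definition lebesgue_rV (R : realType) n : set (rVleb R n) -> \bar R :=
  @completed_measure_extension _ _ _ (borel_lebesgue R n).

HB.instance Definition _ (R : realType) n := Measure.on (@lebesgue_rV R n).

Section function_spaces.
Variables (R : realType) (n : nat).
Implicit Types (f g : 'rV[R]_n -> R[i]) (Q : set 'rV[R]_n) (alpha : R).

Local Notation leb := (@lebesgue_rV R n).
(* The modulus with values in R; `|z| takes its values in R[i]. *)
Local Notation normc := Normc.normc.

Definition cube (a : 'rV[R]_n) (l : R) : set 'rV[R]_n :=
  [set x | forall i, a ord0 i <= x ord0 i <= a ord0 i + l].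

Definition is_cube Q := exists a l, 0 < l /\ Q = cube a l.

Definition volume Q : R := fine (leb Q).

Definition locally_integrableC : set ('rV[R]_n -> R[i]) :=
  [set f : 'rV[R]_n -> R[i] | measurable_fun [set: rVleb R n] (fun x => complex.Re (f x)) /\
           measurable_fun [set: rVleb R n] (fun x => complex.Im (f x)) /\
           forall K : set 'rV[R]_n, compact K ->
             (\int[leb]_(x in K) (normc (f x))%:E < +oo)%E].

Definition integralC Q f : R[i] :=
  Complex (\int[leb]_(x in Q) complex.Re (f x))
          (\int[leb]_(x in Q) complex.Im (f x)).

Definition mean Q f : R[i] := (real_complex R (volume Q)^-1) * integralC Q f.

Definition oscillation alpha f Q : \bar R :=
  ((volume Q `^ (1 + alpha / n%:R))^-1%:E *
   \int[leb]_(x in Q) (normc (f x - mean Q f))%:E)%E.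

Definition BMO_norm alpha f : \bar R :=
  ereal_sup [set oscillation alpha f Q | Q in is_cube].

Definition BMO alpha : set ('rV[R]_n -> R[i]) :=
  [set f : 'rV[R]_n -> R[i] | locally_integrableC f /\ (BMO_norm alpha f < +oo)%E].

Definition iter_partial (s : seq 'I_n) (h : 'rV[R]_n -> R) : 'rV[R]_n -> R :=
  foldr (fun i h' x => 'D_(delta_mx ord0 i) h' x) h s.

Definition smooth (h : 'rV[R]_n -> R) :=
  forall s : seq 'I_n, continuous (iter_partial s h) /\
    forall i x, derivable (iter_partial s h) x (delta_mx ord0 i).

Definition Cc_infty : set ('rV[R]_n -> R[i]) :=
  [set g : 'rV[R]_n -> R[i] | smooth (fun x => complex.Re (g x)) /\
           smooth (fun x => complex.Im (g x)) /\
           compact (closure [set x | g x != 0])].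

Definition CMO_closure alpha : set ('rV[R]_n -> R[i]) :=
  [set f : 'rV[R]_n -> R[i] | BMO alpha f /\
    forall e : R, 0 < e ->
      exists g, Cc_infty g /\ (BMO_norm alpha (f \- g)%R < e%:E)%E].

Definition CMO alpha : set ('rV[R]_n -> R[i]) :=
  [set f : 'rV[R]_n -> R[i] | BMO alpha f /\
    [/\ ereal_sup [set oscillation alpha f Q
          | Q in [set Q | is_cube Q /\ leb Q = r%:E]] @[r --> 0^'+] --> 0%E,
        ereal_sup [set oscillation alpha f Q
          | Q in [set Q | is_cube Q /\ leb Q = r%:E]] @[r --> +oo] --> 0%E &
        ereal_sup [set oscillation alpha f Q
          | Q in [set Q | is_cube Q /\
              Q `&` [set x | forall i, - d <= x ord0 i <= d] = set0]]
          @[d --> +oo] --> 0%E]].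

(* The constant is unique, so these functions, taken up to a.e. equality, are
   identified with the complex numbers. *)
Definition ae_constant : set ('rV[R]_n -> R[i]) :=
  [set f : 'rV[R]_n -> R[i] | exists! c : R[i], {ae leb, forall x, f x = c}].

End function_spaces.

Arguments CMO_closure {R} n alpha.
Arguments CMO {R} n alpha.
Arguments ae_constant : clear implicits.

(* Main.v *)
Require Import Defs.
From HB Require Import structures.
From mathcomp Require Import all_boot all_order all_algebra.
From mathcomp Require Import complex.
From mathcomp Require Import all_classical all_reals all_analysis.
From mathcomp Require Import measurable_realfun.
From mathcomp Require Import zify ring lra.

(* Mean oscillations of complex functions are comparable with those of their
   real and imaginary parts, so everything is done for real functions, with
   averages over cubes as the only measure-theoretic tool.

   CMO is contained in the closure: if u vanishes in the three senses, cut it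
   off, F := chi (u - c), where chi is a tent at a large scale r and c is the
   mean of u over the ball of radius r. Only cubes that are large or far away
   matter for u - c - F, and a doubling argument, in which alpha < 1 makes a
   geometric series converge, bounds the means of u - c on them. As F has
   compact support and small oscillation at scales below some d, the finite
   sum G := sum_k (mean of F over Q_k) eta_k, for a smooth partition of unity
   (eta_k) on a grid of mesh comparable to d, is close to F: cubes of side less
   than d see the Lipschitz constant of G, larger ones are split into cubes of
   side comparable to d.

   The closure is contained in CMO: smooth functions with compact support are
   Lipschitz, so their oscillation over a cube of side l is O(l), which is
   o(l^alpha) as l tends to 0 when alpha < 1.

   For alpha = 1, subdividing a cube of side l into m^n cubes and chaining the
   means shows that oscillations o(s) at scale s = l / m force the oscillation
   at scale l to be 0, whence f is constant. A bump function thus separates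
   CMO_1 from the closure. *)

Set Implicit Arguments.
Unset Strict Implicit.
Unset Printing Implicit Defensive.

Import Order.TTheory GRing.Theory Num.Theory.
Import numFieldNormedType.Exports.

Local Open Scope classical_set_scope.
Local Open Scope ring_scope.

(** * Lebesgue measure of cubes *)

(** The constants of the truncation and of the grid sum depend on [n] and [alpha] only. Hence [eps]
    can be fixed first, and then [r] (from large and far cubes) and [d] (from small cubes),
    independently of each other. The obstacle is the truncation. Up to a constant, [u - F] is
    [(1 - chi) * (u - c)], and the oscillation of such a product contains the mean of [u - c] times
    the oscillation of [chi]. On a cube of side [l < r] that crosses the transition zone the mean
    can be large: for [alpha = 0], doubling bounds it only by a multiple of [eps * log (r / l)]. The
    Lipschitz bound [l / r] of [chi] compensates, so the induction estimates the product of the two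
    and not the mean alone. The grid sum plays the role of a convolution at scale [d]. Being finite,
    it never requires a derivative under an integral, and its smoothness reduces to that of
    functions of one variable. The weight [l ^ alpha] is kept on the right of each estimate, so that
    the norm and the three limit conditions all become inequalities between real numbers. *)

Section measure_cubes.
Variables (R : realType) (n : nat).
Local Notation leb := (@lebesgue_rV R n).

Lemma borel_rVleb (A : set 'rV[R]_n) :
  measurable A -> measurable (A : set (rVleb R n)).
Proof.
move=> mA; apply: (@sub_caratheodory _ _ _ (borel_lebesgue R n)).
exact: sub_sigma_algebra.
Qed.

Lemma lebesgue_rVE (A : set 'rV[R]_n) :
  measurable A -> leb A = borel_lebesgue R n A.
Proof. exact: measurable_mu_extE. Qed.

Lemma measurable_coordE (i : 'I_n) (B : set (measurableTypeR R)) :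
  measurable B -> measurable [set x : 'rV[R]_n | B (x ord0 i)].
Proof.
by move=> mB; rewrite -[X in measurable X]setTI; exact: measurable_rV_coord.
Qed.

Lemma cubeE (a : 'rV[R]_n) l :
  cube a l = \bigcap_(i in [set: 'I_n]) [set x | x ord0 i \in `[a ord0 i, a ord0 i + l]].
Proof.
apply/seteqP; split => x /= xc i; first by move=> _ /=; rewrite in_itv /=; exact: xc.
by have := xc i I; rewrite /= in_itv.
Qed.

Lemma borel_cube (a : 'rV[R]_n) l : measurable (cube a l).
Proof.
rewrite cubeE; apply: fin_bigcap_measurable; first exact: finite_finset.
by move=> i _; apply: (@measurable_coordE i [set` `[a ord0 i, a ord0 i + l]]).
Qed.

Lemma measurable_cube (a : 'rV[R]_n) l : measurable (cube a l : set (rVleb R n)).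
Proof. by apply: borel_rVleb; exact: borel_cube. Qed.

End measure_cubes.

Lemma borel_lebesgue_cube (R : realType) n (a : 'rV[R]_n) l :
  0 <= l -> borel_lebesgue R n (cube a l) = (l ^+ n)%:E.
Proof.
move=> l0; elim: n a => [|n ih] a /=.
  by rewrite expr0 diracE mem_set// => -[].
rewrite /rV_cons_measure /pushforward.
pose a' := rsubmx (a : 'rV_(1 + n)).
rewrite (_ : _ @^-1` _ = [set` `[a ord0 ord0, a ord0 ord0 + l]] `*` cube a' l).
  rewrite product_measure1E; [|exact: measurable_itv|exact: borel_cube].
  transitivity (l%:E * (l ^+ n)%:E)%E; last by rewrite -EFinM exprS.
  congr (_ * _)%E; last exact: ih.
  apply: etrans (lebesgue_measure_itv _) _; rewrite /= lte_fin.
  have [ll|] := ltP (a ord0 ord0) (a ord0 ord0 + l).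
    by rewrite -EFinB; congr _%:E; ring.
  (* The interval is degenerate, that is [l = 0]. *)
  by rewrite gerDl => ll; congr _%:E; apply/eqP; rewrite eq_le l0.
have e0 : ord0 = lshift n (ord0 : 'I_1) by apply/val_inj.
have e1 (p : R * 'rV[R]_n) : rV_cons p ord0 ord0 = p.1.
  by rewrite e0; apply: etrans (row_mxEl _ _ _ _) _; rewrite mxE.
have e2 (p : R * 'rV[R]_n) j : rV_cons p ord0 (rshift 1 j : 'I_n.+1) = p.2 ord0 j.
  exact: row_mxEr.
apply/seteqP; split => -[x y] /=.
  move=> h; split.
    by have := h ord0; rewrite e1 in_itv.
  by move=> i; have := h (rshift 1 i : 'I_n.+1); rewrite e2 mxE.
move=> [h1 h2] i; case: (split_ordP (i : 'I_(1 + n))) => j ->.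
  by rewrite (ord1 j) -e0 e1; rewrite in_itv in h1.
by rewrite e2; have := h2 j; rewrite mxE.
Qed.

Section measure_cubes2.
Variables (R : realType) (n : nat).
Local Notation leb := (@lebesgue_rV R n).

Lemma lebesgue_cube (a : 'rV[R]_n) l : 0 <= l -> leb (cube a l) = (l ^+ n)%:E.
Proof.
by move=> l0; rewrite lebesgue_rVE ?borel_lebesgue_cube//; exact: borel_cube.
Qed.

Lemma volume_cube (a : 'rV[R]_n) l : 0 <= l -> volume (cube a l) = l ^+ n.
Proof. by move=> l0; rewrite /volume lebesgue_cube. Qed.

Lemma normrV_coord (x : 'rV[R]_n) i : `|x ord0 i| <= `|x|.
Proof.
rewrite [leRHS]/Num.norm/= mx_normrE.
by have := @le_bigmax _ _ _ 0 (fun j : 'I_1 * 'I_n => `|x j.1 j.2|) (ord0, i).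
Qed.

Lemma normrV_le (x : 'rV[R]_n) M : 0 <= M ->
  (forall i, `|x ord0 i| <= M) -> `|x| <= M.
Proof.
move=> M0 xM; rewrite [leLHS]/Num.norm/= mx_normrE; apply: bigmax_le => // -[i j] _ /=.
by rewrite (ord1 i).
Qed.

(** The sigma-algebra is generated by the coordinates, so an open set has to be exhausted by
    countably many products: the cubes with rational corner and dyadic side that it contains. *)
Lemma open_borel (U : set 'rV[R]_n) : open U -> measurable U.
Proof.
move=> oU.
pose q (p : 'rV[rat]_n * nat) : set 'rV[R]_n :=
  cube (\row_i ratr (p.1 ord0 i)) (2 ^- p.2).
rewrite (_ : U = \bigcup_p [set x | q p `<=` U /\ q p x]).
  apply: countable_bigcupT_measurable => // p.
  have [pU|pU] := pselect (q p `<=` U).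
    by rewrite (_ : [set _ | _] = q p); [exact: borel_cube|apply/seteqP; split => x // []].
  by rewrite (_ : [set _ | _] = set0)//; apply/seteqP; split => x // -[].
apply/seteqP; split => [x Ux|x [p /= _ [pU]]]; last exact: pU.
have /nbhs_ballP [e /= e0 xeU] := open_nbhs_nbhs (conj oU Ux).
have [k ke] : exists k, 2 ^- k < e.
  have [k _ kP] : \forall k \near \oo, (2^-1 : R) ^+ k < e.
    have := @cvg_geometric R 1 2^-1.
    rewrite ger0_norm ?invr_ge0// invf_lt1 ?ltr1n// => /(_ isT).
    move=> /cvgrPdist_lt /(_ _ e0); apply: filterS => k /=.
    by rewrite sub0r normrN mul1r ger0_norm ?exprn_ge0 ?invr_ge0.
  by exists k; rewrite -exprVn; apply: kP => /=.
have h i : {r : rat | ratr r \in `]x ord0 i - 2 ^- k, x ord0 i[}.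
  apply: cid; apply: rat_in_itvoo.
  by rewrite gtrDl oppr_lt0 invr_gt0 exprn_gt0.
pose y := \row_i sval (h i).
exists (y, k) => //=; split.
  move=> z; rewrite /q /= => zc; apply: xeU; split => // i j.
  rewrite (ord1 i) /ball /=.
  have := zc j; rewrite !mxE; have := svalP (h j); rewrite in_itv /= => /andP[h1 h2] /andP[h3 h4].
  rewrite ltr_norml; apply/andP; split; lra.
move=> i; rewrite !mxE; have := svalP (h i); rewrite in_itv /= => /andP[h1 h2].
apply/andP; split; lra.
Qed.

Lemma continuous_borel (h : 'rV[R]_n -> R) : continuous h ->
  measurable_fun [set: 'rV[R]_n] h.
Proof.
move=> /continuousP ch; apply: (measurability _ (measurable_realfun.RGenOpens.measurableE R)).
move=> _ [_ [a [b ->] <-]]; rewrite setTI; apply: open_borel.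
exact/ch/interval_open.
Qed.

Lemma continuous_rVleb (h : 'rV[R]_n -> R) : continuous h ->
  measurable_fun [set: rVleb R n] h.
Proof.
move=> /continuous_borel mh _ B mB; apply: borel_rVleb; exact: mh.
Qed.

End measure_cubes2.

(** * Averages and mean oscillation *)

(* Locked: otherwise unification unfolds the integral. *)
HB.lock Definition avg (R : realType) (n : nat) (u : 'rV[R]_n -> R)
    (a : 'rV[R]_n) (l : R) : R :=
  (l ^+ n)^-1 * \int[@lebesgue_rV R n]_(x in cube a l) u x.

Section averages.
Variables (R : realType) (n : nat).
Local Notation leb := (@lebesgue_rV R n).
Implicit Types (u v : 'rV[R]_n -> R) (a b x y : 'rV[R]_n) (l m c : R).

Definition cube_integrable u :=
  measurable_fun [set: rVleb R n] u /\
  forall a l, 0 < l -> leb.-integrable (cube a l) (EFin \o (u : rVleb R n -> R)).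

(** Normalised by the volume alone; the factor [l ^ alpha] appears on the other side of the
    estimates. *)
Definition mean_osc u a l : R := avg (fun x => `|u x - avg u a l|) a l.

Lemma cube_integrable_le u v : cube_integrable u ->
  measurable_fun [set: rVleb R n] v -> (forall x, `|v x| <= `|u x|) ->
  cube_integrable v.
Proof.
move=> [mu iu] mv vu; split=> // a l l0.
apply: le_integrable (iu a l l0) => //; first exact: measurable_cube.
  by apply/measurable_EFinP; exact: measurable_funS mv.
by move=> x _ /=; rewrite lee_fin.
Qed.

Lemma cube_integrableD u v : cube_integrable u -> cube_integrable v ->
  cube_integrable (fun x => u x + v x).
Proof.
move=> [mu iu] [mv iv]; split=> [|a l l0]; first exact: measurable_funD.
by have := integrableD (measurable_cube a l) (iu a l l0) (iv a l l0).
Qed.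

Lemma cube_integrable_cst c : cube_integrable (fun=> c).
Proof.
split=> [|a l l0]; first exact: measurable_cst.
apply/integrableP; split; first by apply: measurable_cst.
rewrite (eq_integral (fun=> `|c|%:E))//= integral_cst; last exact: measurable_cube.
by rewrite [X in (_ * X)%E](lebesgue_cube a (ltW l0)) -EFinM ltry.
Qed.

Lemma cube_integrableN u : cube_integrable u -> cube_integrable (fun x => - u x).
Proof.
move=> uI; apply: (cube_integrable_le uI) => [|x]; last by rewrite normrN.
by apply: measurable_funN; exact: uI.1.
Qed.

Lemma cube_integrableB u v : cube_integrable u -> cube_integrable v ->
  cube_integrable (fun x => u x - v x).
Proof. by move=> uI vI; apply: cube_integrableD uI _; exact: cube_integrableN. Qed.

Lemma cube_integrable_norm u : cube_integrable u -> cube_integrable (fun x => `|u x|).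
Proof.
move=> uI; apply: (cube_integrable_le uI) => [|x]; last by rewrite normr_id.
by apply: measurableT_comp; [exact: normr_measurable|exact: uI.1].
Qed.

Lemma cube_integrableM u v : cube_integrable u ->
  measurable_fun [set: rVleb R n] v -> (forall x, `|v x| <= 1) ->
  cube_integrable (fun x => v x * u x).
Proof.
move=> uI mv v1; apply: (cube_integrable_le uI) => [|x].
  by apply: measurable_funM mv _; exact: uI.1.
by rewrite normrM ler_piMl.
Qed.

Lemma avgD u v a l : 0 < l -> cube_integrable u -> cube_integrable v ->
  avg (fun x => u x + v x) a l = avg u a l + avg v a l.
Proof.
move=> l0 [mu iu] [mv iv]; rewrite avg.unlock RintegralD ?mulrDr//.
- exact: measurable_cube.
- exact: iu.
- exact: iv.
Qed.

Lemma cube_integrableZ u c : cube_integrable u -> cube_integrable (fun x => c * u x).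
Proof.
move=> [mu iu]; split=> [|a l l0].
  by apply: measurable_funM => //; exact: measurable_cst.
by have := integrableZl (measurable_cube a l) c (iu a l l0).
Qed.

Lemma avgZ u c a l : 0 < l -> cube_integrable u ->
  avg (fun x => c * u x) a l = c * avg u a l.
Proof.
move=> l0 uI; rewrite avg.unlock RintegralZl 1?mulrCA//; first exact: measurable_cube.
exact: uI.2.
Qed.

Lemma avg_cst c a l : 0 < l -> avg (fun=> c) a l = c.
Proof.
move=> l0; rewrite avg.unlock Rintegral_cst; last exact: measurable_cube.
rewrite -/(volume (cube a l)) volume_cube ?ltW// mulrCA mulVf ?mulr1//.
by rewrite gt_eqF// exprn_gt0.
Qed.

Lemma avgB u v a l : 0 < l -> cube_integrable u -> cube_integrable v ->
  avg (fun x => u x - v x) a l = avg u a l - avg v a l.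
Proof.
move=> l0 [mu iu] [mv iv]; rewrite avg.unlock RintegralB ?mulrBr//.
- exact: measurable_cube.
- exact: iu.
- exact: iv.
Qed.

Lemma le_avg u v a l : 0 < l -> cube_integrable u -> cube_integrable v ->
  (forall x, cube a l x -> u x <= v x) -> avg u a l <= avg v a l.
Proof.
move=> l0 uI vI uv; rewrite avg.unlock ler_wpM2l ?invr_ge0 ?exprn_ge0 ?(ltW l0)//.
apply: le_Rintegral => //; first exact: measurable_cube.
- exact: uI.2.
- exact: vI.2.
Qed.

Lemma eq_avg u v a l :
  (forall x, cube a l x -> u x = v x) -> avg u a l = avg v a l.
Proof.
by move=> uv; rewrite avg.unlock; congr (_ * _); apply: eq_Rintegral => x /set_mem; exact: uv.
Qed.

Lemma avg_ge0 u a l : 0 < l -> (forall x, cube a l x -> 0 <= u x) -> 0 <= avg u a l.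
Proof.
move=> l0 u0; rewrite avg.unlock mulr_ge0 ?invr_ge0 ?exprn_ge0 ?(ltW l0)//.
exact: Rintegral_ge0.
Qed.

Lemma avg_le_cst u c a l : 0 < l -> cube_integrable u ->
  (forall x, cube a l x -> u x <= c) -> avg u a l <= c.
Proof.
move=> l0 uI uc; rewrite -[leRHS](avg_cst c a l0).
by apply: le_avg => //; exact: cube_integrable_cst.
Qed.

Lemma le_norm_avg u a l : 0 < l -> cube_integrable u ->
  `|avg u a l| <= avg (fun x => `|u x|) a l.
Proof.
move=> l0 uI; rewrite avg.unlock normrM ger0_norm ?invr_ge0 ?exprn_ge0 ?(ltW l0)//.
rewrite ler_wpM2l ?invr_ge0 ?exprn_ge0 ?(ltW l0)//.
apply: le_normr_Rintegral; first exact: measurable_cube.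
exact: uI.2.
Qed.

Lemma norm_avg_sub u c a l : 0 < l -> cube_integrable u ->
  `|avg u a l - c| <= avg (fun x => `|u x - c|) a l.
Proof.
move=> l0 uI; have cI := cube_integrable_cst c.
rewrite -[X in _ - X](avg_cst c a l0) -avgB; [|exact: l0|exact: uI|exact: cI].
by apply: le_norm_avg l0 _; exact: cube_integrableB.
Qed.

(** The factor is the ratio of the volumes. Only points where [u] is nonzero must lie in the second
    cube, which covers both nested cubes and functions supported in a fixed cube. *)
Lemma avg_le_cube u a l b m : 0 < l -> 0 < m -> cube_integrable u ->
  (forall x, 0 <= u x) -> (forall x, cube a l x -> u x != 0 -> cube b m x) ->
  avg u a l <= (m / l) ^+ n * avg u b m.
Proof.
move=> l0 m0 uI u0 ab.
have -> : (m / l) ^+ n * avg u b m = (l ^+ n)^-1 * \int[leb]_(x in cube b m) u x.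
  rewrite avg.unlock expr_div_n mulrA; congr (_ * _).
  by rewrite mulrAC mulfV ?mul1r// gt_eqF// exprn_gt0.
rewrite avg.unlock ler_wpM2l ?invr_ge0 ?exprn_ge0 ?(ltW l0)//.
have -> : \int[leb]_(x in cube a l) u x = \int[leb]_(x in cube a l `&` cube b m) u x.
  rewrite [RHS]Rintegral_mkcondr; apply: eq_Rintegral => x /set_mem xal.
  rewrite patchE; case: ifPn => // /negP xb; apply/eqP/negPn/negP => ux0; apply: xb.
  by apply/mem_set/(ab x).
apply: fine_le.
- apply: integrable_fin_num; first by apply: measurableI; exact: measurable_cube.
  apply: integrableS (uI.2 a l l0) => //; first exact: measurable_cube.
  by apply: measurableI; exact: measurable_cube.
- apply: integrable_fin_num; [exact: measurable_cube|exact: uI.2].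
apply: ge0_subset_integral.
- by apply: measurableI; exact: measurable_cube.
- exact: measurable_cube.
- by apply/measurable_EFinP; exact: measurable_funS uI.1.
- by move=> x _; rewrite lee_fin.
- exact: subIsetr.
Qed.

Lemma cube_integrable_dev u c : cube_integrable u ->
  cube_integrable (fun x => `|u x - c|).
Proof.
move=> uI; apply/cube_integrable_norm/cube_integrableB => //.
exact: cube_integrable_cst.
Qed.

Lemma mean_osc_ge0 u a l : 0 < l -> 0 <= mean_osc u a l.
Proof. by move=> l0; apply: avg_ge0. Qed.

(** The mean itself is within [avg |u - c|] of [c], whence the factor 2. *)
Lemma mean_osc_le u c a l : 0 < l -> cube_integrable u ->
  mean_osc u a l <= 2 * avg (fun x => `|u x - c|) a l.
Proof.
move=> l0 uI; have h := norm_avg_sub c a l0 uI.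
apply: (@le_trans _ _ (avg (fun x => `|u x - c| + `|avg u a l - c|) a l)).
  apply: le_avg => [//|||x _]; first exact: cube_integrable_dev.
    apply: cube_integrableD; first exact: cube_integrable_dev.
    exact: cube_integrable_cst.
  rewrite [`|avg u a l - c|]distrC; exact: ler_distD.
rewrite avgD; [|exact: l0|exact: cube_integrable_dev|exact: cube_integrable_cst].
by rewrite avg_cst//; lra.
Qed.

Lemma mean_oscD u v a l : 0 < l -> cube_integrable u -> cube_integrable v ->
  mean_osc (fun x => u x + v x) a l <= mean_osc u a l + mean_osc v a l.
Proof.
move=> l0 uI vI; rewrite /mean_osc.
rewrite -avgD; [|exact: l0|exact: cube_integrable_dev|exact: cube_integrable_dev].
apply: le_avg => [//|||x _].
- by apply: cube_integrable_dev; exact: cube_integrableD.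
- by apply: cube_integrableD; exact: cube_integrable_dev.
rewrite avgD; [|exact: l0|exact: uI|exact: vI].
by rewrite opprD addrACA; exact: ler_normD.
Qed.

Lemma mean_oscN u a l : 0 < l -> cube_integrable u ->
  mean_osc (fun x => - u x) a l = mean_osc u a l.
Proof.
move=> l0 uI; apply: eq_avg => x _.
have -> : avg (fun x => - u x) a l = - avg u a l.
  have := avgB a l0 (cube_integrable_cst 0) uI.
  by rewrite avg_cst// sub0r => <-; apply: eq_avg => y _; rewrite sub0r.
by rewrite -opprD normrN.
Qed.

Lemma mean_oscB u v a l : 0 < l -> cube_integrable u -> cube_integrable v ->
  mean_osc (fun x => u x - v x) a l <= mean_osc u a l + mean_osc v a l.
Proof.
move=> l0 uI vI; rewrite -(mean_oscN a l0 vI); apply: mean_oscD l0 uI _.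
exact: cube_integrableN.
Qed.

Lemma mean_osc_shift u c a l : 0 < l -> cube_integrable u ->
  mean_osc (fun x => u x - c) a l = mean_osc u a l.
Proof.
move=> l0 uI; apply: eq_avg => x _.
rewrite avgB ?avg_cst//; last exact: cube_integrable_cst.
by congr `|_|; ring.
Qed.

Lemma eq_mean_osc u v a l :
  (forall x, cube a l x -> u x = v x) -> mean_osc u a l = mean_osc v a l.
Proof.
by move=> uv; apply: eq_avg => x xc; rewrite uv//; congr `|_ - _|; exact: eq_avg.
Qed.

Lemma mean_osc_cst c a l : 0 < l -> mean_osc (fun=> c) a l = 0.
Proof.
by move=> l0; rewrite /mean_osc !avg_cst// subrr normr0.
Qed.

Lemma avg_sub_le u a l b m : 0 < l -> 0 < m -> cube_integrable u ->
  cube a l `<=` cube b m ->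
  `|avg u a l - avg u b m| <= (m / l) ^+ n * mean_osc u b m.
Proof.
move=> l0 m0 uI ab; apply: le_trans (norm_avg_sub _ _ l0 uI) _.
apply: avg_le_cube => [//|//||//|x /ab //]; exact: cube_integrable_dev.
Qed.

Lemma cube_split a s (m : nat) x : 0 < s -> (0 < m)%N -> cube a (m%:R * s) x ->
  exists k : {ffun 'I_n -> 'I_m}, cube (a + \row_i ((k i)%:R * s)) s x.
Proof.
case: m => // m s0 _ xc.
have h i : exists j : 'I_m.+1, a ord0 i + j%:R * s <= x ord0 i <= a ord0 i + j%:R * s + s.
  have /andP[h1 h2] := xc i.
  pose t := (x ord0 i - a ord0 i) / s.
  have t0 : 0 <= t by rewrite divr_ge0 ?subr_ge0// ltW.
  have tE : t * s = x ord0 i - a ord0 i by rewrite mulfVK ?gt_eqF.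
  have [tm|tm] := ltP t m%:R.
    have /andP[j1 j2] := truncn_itv t0.
    have jm : (Num.truncn t < m.+1)%N.
      rewrite ltnS -(ler_nat R); exact: le_trans j1 (ltW tm).
    exists (Ordinal jm) => /=; move: j1 j2 tE; rewrite -addn1 natrD.
    set k := _%:R => j1 j2 tE; apply/andP; split; nra.
  (* On the closed far face the truncation of [t] would be one too large, so the last cell takes
     every [t >= m]. *)
  exists ord_max => /=; move: h2 tm tE; rewrite (_ : m.+1%:R = m%:R + 1); last by rewrite -addn1 natrD.
  set k := m%:R => *; apply/andP; split; nra.
exists [ffun i => projT1 (cid (h i))] => i; rewrite !mxE ffunE.
by case: cid => j.
Qed.

(** The closed subcubes overlap along their faces. For nonnegative [u] it is enough that [u] is at
    most the sum of its restrictions to them, so no disjoint decomposition is built. *)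
Lemma avg_split u a s (m : nat) B : 0 < s -> (0 < m)%N -> cube_integrable u ->
  (forall x, 0 <= u x) ->
  (forall k : {ffun 'I_n -> 'I_m}, avg u (a + \row_i ((k i)%:R * s)) s <= B) ->
  avg u a (m%:R * s) <= B.
Proof.
move=> s0 m0 uI u0 uB; have ms0 : 0 < m%:R * s by rewrite mulr_gt0 ?ltr0n.
have uBs (k : {ffun 'I_n -> 'I_m}) : \int[leb]_(x in cube (a + \row_i ((k i)%:R * s)) s) u x <= s ^+ n * B.
  by have := uB k; rewrite avg.unlock ler_pdivrMl ?exprn_gt0.
rewrite avg.unlock ler_pdivrMl ?exprn_gt0//.
apply: (@le_trans _ _ (\sum_(k : {ffun 'I_n -> 'I_m}) s ^+ n * B)); last first.
  by rewrite sumr_const card_ffun !card_ord exprMn -mulrA -[leLHS]mulr_natl natrX.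
apply: (@le_trans _ _ (\sum_(k : {ffun 'I_n -> 'I_m})
    \int[leb]_(x in cube (a + \row_i ((k i)%:R * s)) s) u x)); last first.
  exact: ler_sum.
have fin b l : 0 < l -> (\int[leb]_(x in cube b l) (u x)%:E)%E \is a fin_num.
  by move=> l0; apply: integrable_fin_num; [exact: measurable_cube|exact: uI.2].
rewrite -lee_fin /Rintegral fineK ?fin// -sumEFin.
under eq_bigr do rewrite fineK ?fin//.
pose F (k : {ffun 'I_n -> 'I_m}) : set (rVleb R n) := cube (a + \row_i ((k i)%:R * s)) s.
have mF k : measurable (F k) by exact: measurable_cube.
have mu A : measurable_fun A (EFin \o (u : rVleb R n -> R)).
  by apply/measurable_EFinP; exact: measurable_funS uI.1.
apply: (@le_trans _ _ (\int[leb]_(x in cube a (m%:R * s)) (\sum_k ((u \_ (F k)) x)%:E))%E).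
  apply: ge0_le_integral; first exact: measurable_cube.
  - by move=> x _; rewrite lee_fin.
  - exact: mu.
  - apply: emeasurable_sum => k; apply/measurable_EFinP.
    by apply/measurable_restrict => //; [exact: measurable_cube|exact: measurable_funS uI.1].
  move=> x /(cube_split s0 m0)[k xk].
  rewrite sumEFin lee_fin (bigD1 k)//= patchE mem_set// lerDl sumr_ge0// => j _.
  by rewrite patchE; case: ifP.
rewrite ge0_integral_sum; last 3 first.
- exact: measurable_cube.
- move=> k; apply/measurable_EFinP.
  by apply/measurable_restrict => //; [exact: measurable_cube|exact: measurable_funS uI.1].
- by move=> k x _; rewrite lee_fin patchE; case: ifP.
apply: lee_sum => k _.
rewrite (_ : integral _ _ _ = \int[leb]_(x in cube a (m%:R * s))
    (((EFin \o (u : rVleb R n -> R)) \_ (F k)) x))%E; last first.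
  by apply: eq_integral => x _; rewrite restrict_EFin.
rewrite -integral_mkcondr; apply: ge0_subset_integral.
- by apply: measurableI; exact: measurable_cube.
- exact: measurable_cube.
- exact: mu.
- by move=> x _; rewrite lee_fin.
- exact: subIsetr.
Qed.

End averages.

(** * Truncation *)

Section cube_geometry.
Variables (R : realType) (n : nat).
Implicit Types (a x y : 'rV[R]_n) (l r : R).

(** The norm of ['rV[R]_n] is the maximum norm, so its closed balls are cubes. *)
Lemma cube_center y r x : 0 <= r ->
  cube (y - const_mx r) (2 * r) x <-> `|x - y| <= r.
Proof.
move=> r0; split => [xc|xyr i].
  by apply: normrV_le => // i; have := xc i; rewrite !mxE ler_norml => /andP[? ?]; lra.
have := le_trans (normrV_coord _ i) xyr; rewrite !mxE ler_norml => /andP[? ?].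
by apply/andP; split; lra.
Qed.

Lemma cube_dist a l x y : 0 <= l -> cube a l x -> cube a l y -> `|x - y| <= l.
Proof.
move=> l0 xc yc; apply: normrV_le => // i; rewrite !mxE ler_norml.
by have /andP[? ?] := xc i; have /andP[? ?] := yc i; apply/andP; split; lra.
Qed.

Lemma cube_corner a l : 0 <= l -> cube a l a.
Proof. by move=> l0 i; rewrite lexx lerDl. Qed.

Lemma cube_double a l : 0 <= l -> cube a l `<=` cube a (2 * l).
Proof. by move=> l0 x xc i; have /andP[? ?] := xc i; apply/andP; split; lra. Qed.

End cube_geometry.

Section powR_modulus.
Variables (R : realType) (alpha : R).
Hypothesis alpha01 : 0 <= alpha <= 1.
Local Notation w l := (l `^ alpha).

Lemma powRM_le k l : 1 <= k -> 0 < l -> w (k * l) <= k * w l.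
Proof.
move=> k1 l0; have k0 : 0 <= k by lra.
rewrite powRM ?(ltW l0)// ler_wpM2r ?powR_ge0//.
by have := ler_powR k1 (proj2 (andP alpha01)); rewrite powRr1.
Qed.

Lemma le_powR_l l m : 0 < l -> l <= m -> w l <= w m.
Proof.
move=> l0 lm; rewrite ge0_ler_powR ?nnegrE//; first by case/andP: alpha01.
  exact: ltW.
lra.
Qed.

(** Monotonicity of [l ^ (1 - alpha)], cleared of denominators. *)
Lemma powR_ratio l m : 0 < l -> l <= m -> l * w m <= m * w l.
Proof.
move=> l0 lm; have -> : w m = w (m / l * l) by rewrite mulfVK// gt_eqF.
apply: (@le_trans _ _ (l * (m / l * w l))).
  by rewrite ler_wpM2l ?(ltW l0)// powRM_le// ler_pdivlMr// mul1r.
by rewrite mulrA mulrCA mulfV ?mulr1// gt_eqF.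
Qed.

End powR_modulus.

Lemma exists_dyadic_le (R : realType) (r l : R) : 0 < l -> exists j : nat, r / 2 ^+ j <= l.
Proof.
move=> l0; exists (Num.truncn (r / l)).+1.
rewrite ler_pdivrMr ?exprn_gt0// mulrC -ler_pdivrMr//.
apply: le_trans (ltW (truncnS_gt _)) _; rewrite -natrX ler_nat.
exact/ltnW/ltn_expl.
Qed.

Section truncation.
Variables (R : realType) (n : nat).
Implicit Types (u : 'rV[R]_n -> R) (a x y : 'rV[R]_n) (l m c r : R).

(** Piecewise linear in the norm; smoothness is produced only afterwards, by the grid sum. *)
Definition cutoff r x : R := Num.min 1 (Num.max 0 (2 - `|x| / r)).

Lemma cutoffE r x : cutoff r x = if 2 <= `|x| / r then 0 else
  if `|x| / r <= 1 then 1 else 2 - `|x| / r.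
Proof.
rewrite /cutoff; case: ifPn => [h|]; first by rewrite max_l ?min_r//; lra.
rewrite -ltNge => h; rewrite max_r; last lra.
case: ifPn => [h'|]; first by rewrite min_l//; lra.
by rewrite -ltNge => h'; rewrite min_r//; lra.
Qed.

Lemma cutoff_ge0 r x : 0 <= cutoff r x.
Proof. by rewrite le_min ler01 le_max lexx. Qed.

Lemma cutoff_le1 r x : cutoff r x <= 1.
Proof. by rewrite /cutoff ge_min lexx. Qed.

Lemma cutoff_in r x : 0 < r -> `|x| <= r -> cutoff r x = 1.
Proof.
move=> r0 xr; have h : `|x| / r <= 1 by rewrite ler_pdivrMr// mul1r.
by rewrite cutoffE h ifF//; apply/negbTE; rewrite -ltNge; lra.
Qed.

Lemma cutoff_out r x : 0 < r -> 2 * r < `|x| -> cutoff r x = 0.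
Proof. by move=> r0 xr; rewrite cutoffE ler_pdivlMr// ltW. Qed.

Lemma cutoff_lipschitz r x y : 0 < r ->
  `|cutoff r x - cutoff r y| <= `|x - y| / r.
Proof.
move=> r0; have : `| `|x| / r - `|y| / r | <= `|x - y| / r.
  by rewrite -mulrBl normrM (@gtr0_norm _ r^-1) ?invr_gt0// ler_pM2r ?invr_gt0// ler_dist_dist.
rewrite !cutoffE; move: (_ / r) (_ / r) (_ / r) => p q d.
rewrite !ler_norml => /andP[? ?].
by do ?(case: ifPn; rewrite -?ltNge => ?); apply/andP; split; lra.
Qed.

Lemma measurable_cutoff r : measurable_fun [set: rVleb R n] (cutoff r).
Proof.
apply: measurable_minr; first exact: measurable_cst.
apply: measurable_maxr; first exact: measurable_cst.
apply: measurable_funB; first exact: measurable_cst.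
apply: measurable_funM; last exact: measurable_cst.
by apply: continuous_rVleb => x; exact: norm_continuous.
Qed.

(** Product rule: [phi * u - t * m = phi * (u - m) + m * (phi - t)] for [m] the mean of [u]. The
    value [t] is left free, since it is 1 on large or far cubes and a value of [phi] on small
    ones. *)
Lemma mean_oscM_le u (phi : 'rV[R]_n -> R) t a l : 0 < l ->
  cube_integrable u -> measurable_fun [set: rVleb R n] phi ->
  (forall x, `|phi x| <= 1) ->
  mean_osc (fun x => phi x * u x) a l <=
    2 * mean_osc u a l + 2 * (`|avg u a l| * avg (fun x => `|phi x - t|) a l).
Proof.
move=> l0 uI mphi phi1.
have phiI : cube_integrable phi.
  have := cube_integrableM (@cube_integrable_cst R n 1) mphi phi1.
  by under eq_fun do rewrite mulr1.
have puI := cube_integrableM uI mphi phi1.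
apply: le_trans (mean_osc_le (t * avg u a l) _ l0 puI) _.
rewrite -mulrDr ler_wpM2l//.
pose g x := `|avg u a l| * `|phi x - t|.
have ptI : cube_integrable (fun x => phi x - t).
  exact/cube_integrableB/cube_integrable_cst.
have gI : cube_integrable g by apply/cube_integrableZ/cube_integrable_norm.
have avgg : avg g a l = `|avg u a l| * avg (fun x => `|phi x - t|) a l.
  by apply: avgZ l0 _; exact: cube_integrable_norm.
rewrite -avgg -avgD; [|exact: l0|exact: cube_integrable_dev|exact: gI].
apply: le_avg => [//|||x _].
- exact: cube_integrable_dev.
- by apply: cube_integrableD; [exact: cube_integrable_dev|exact: gI].
rewrite /g.
have -> : phi x * u x - t * avg u a l =
  phi x * (u x - avg u a l) + avg u a l * (phi x - t) by ring.
apply: le_trans (ler_normD _ _) _; rewrite !normrM lerD2r.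
by rewrite ler_piMl.
Qed.


Lemma cutoff_dev r x : `|1 - cutoff r x - 1| = cutoff r x.
Proof. by rewrite addrC addKr normrN ger0_norm// cutoff_ge0. Qed.

Lemma cube_integrable_bounded (phi : 'rV[R]_n -> R) :
  measurable_fun [set: rVleb R n] phi -> (forall x, `|phi x| <= 1) ->
  cube_integrable phi.
Proof.
move=> mphi phi1; have := cube_integrableM (@cube_integrable_cst R n 1) mphi phi1.
by under eq_fun do rewrite mulr1.
Qed.

Lemma cutoff_compl_le1 r x : `|1 - cutoff r x| <= 1.
Proof.
rewrite ler_norml; have := cutoff_ge0 r x; have := cutoff_le1 r x.
by move=> ? ?; apply/andP; split; lra.
Qed.

Lemma measurable_cutoff_compl r :
  measurable_fun [set: rVleb R n] (fun x => 1 - cutoff r x).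
Proof. by apply: measurable_funB; [exact: measurable_cst|exact: measurable_cutoff]. Qed.

(** The integrand is the cut-off, at most 1 and supported in a cube of side [4 * r]. *)
Lemma avg_cutoff_le r a l : 0 < r -> 0 < l ->
  avg (fun x => `|1 - cutoff r x - 1|) a l <= (4 * r / l) ^+ n.
Proof.
move=> r0 l0; have r4 : 0 < 2 * (2 * r) by lra.
have chiI : cube_integrable (cutoff r).
  apply: cube_integrable_bounded (measurable_cutoff r) _ => x.
  by rewrite ger0_norm ?cutoff_ge0 ?cutoff_le1.
rewrite (@eq_avg _ _ _ (cutoff r)); last by move=> x _; exact: cutoff_dev.
have -> : 4 * r = 2 * (2 * r) by ring.
apply: (le_trans (avg_le_cube (b := 0 - const_mx (2 * r)) l0 r4 chiI (cutoff_ge0 r) _)).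
  move=> x _ chi0; apply/cube_center; first by lra.
  by rewrite subr0 leNgt; apply: contra chi0 => /cutoff_out -> //.
apply: ler_piMr; first by apply/exprn_ge0/divr_ge0; exact: ltW.
by apply: avg_le_cst => // x _; exact: cutoff_le1.
Qed.

Section average_growth.
Variables (alpha eps r : R) (u : 'rV[R]_n -> R) (x0 y0 : 'rV[R]_n).
Local Notation w l := (l `^ alpha).
Local Notation c := (avg u (0 - const_mx r) (2 * r)).
Hypotheses (alpha01 : 0 <= alpha <= 1) (eps0 : 0 < eps) (r0 : 0 < r).
Hypotheses (uI : cube_integrable u) (y0r : `|y0| <= 2 * r).
Hypothesis osc : forall b m, 0 < m -> cube b m x0 -> mean_osc u b m <= eps * w m.

(** The cube of centre 0 and half-side [2 * r + m] links the two means: it contains the cube that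
    defines [c], and also [cube b m], which meets the ball of radius [2 * r] at [y0]. *)
Let cubes_common b m (q := 2 * r + m) : r <= m -> cube b m y0 ->
  cube b m `<=` cube (0 - const_mx q) (2 * q) /\
  cube (0 - const_mx r : 'rV[R]_n) (2 * r) `<=` cube (0 - const_mx q) (2 * q).
Proof.
have r0' := r0; rewrite /q => rm y0b; have m0 : 0 <= m by exact: le_trans (ltW r0) rm.
have q0 : 0 <= 2 * r + m by lra.
split=> x.
  move=> xb; apply/cube_center => //.
  by have := cube_dist m0 y0b xb; have := ler_distD y0 x 0; move: y0r; rewrite !subr0 distrC; lra.
by move=> /cube_center xb; apply/cube_center => //; have := xb (ltW r0); lra.
Qed.

(** Both means are compared with the mean over the common cube. Its side is at most [6 * m], which
    gives the volume ratios [6 ^+ n] and [(3 * m / r) ^+ n] and the bound [6 * (eps * w m)] for its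
    oscillation. *)
Lemma avg_big_cube b m : r <= m -> cube b m x0 -> cube b m y0 ->
  `|avg u b m - c| <= (6 ^+ n + (3 * m / r) ^+ n) * (6 * (eps * w m)).
Proof.
have r0' := r0; move=> rm x0b y0b; have [bq Qq] := cubes_common rm y0b.
move: bq Qq; set q := 2 * r + m => bq Qq.
have m0 : 0 < m by exact: lt_le_trans rm.
have q0 : 0 < 2 * q by rewrite /q; lra.
have r20 : 0 < 2 * r by lra.
have q6 : 2 * q <= 6 * m by rewrite /q; lra.
have oscq : mean_osc u (0 - const_mx q) (2 * q) <= 6 * (eps * w m).
  apply: le_trans (osc q0 (bq _ x0b)) _.
  rewrite mulrCA ler_wpM2l ?(ltW eps0)//.
  have := le_powR_l alpha01 q0 q6.
  by move=> /le_trans; apply; apply: powRM_le => //; rewrite ler1n.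
have h1 := avg_sub_le m0 q0 uI bq; have h2 := avg_sub_le r20 q0 uI Qq.
have osc0 := mean_osc_ge0 u (0 - const_mx q) q0.
apply: le_trans (ler_distD (avg u (0 - const_mx q) (2 * q)) _ _) _.
rewrite [`|avg u (0 - const_mx q) (2 * q) - c|]distrC [leRHS]mulrDl.
have pow_le (s t : R) : 0 <= s -> s <= t -> s ^+ n <= t ^+ n.
  by move=> s0 st; apply: lerXn2r; rewrite ?nnegrE//; exact: le_trans st.
have s1 : 0 <= 2 * q / m by apply: divr_ge0; exact: ltW.
have s2 : 0 <= 2 * q / (2 * r) by apply: divr_ge0; exact: ltW.
apply: lerD.
  apply: le_trans h1 _; apply: ler_pM oscq => //; first exact: exprn_ge0.
  by apply: pow_le; rewrite ?ler_pdivrMr.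
apply: le_trans h2 _; apply: ler_pM oscq => //; first exact: exprn_ge0.
apply: pow_le; rewrite ?ler_pdivrMr//.
by have -> : 3 * m / r * (2 * r) = 6 * m by field; rewrite gt_eqF.
Qed.

(* Compare with the doubled cube until the side reaches [r]; the factor
   [2 `^ alpha / 2 < 1] gained at each doubling makes the bound inductive. *)
Lemma avg_small_cube (K : R) : 24 * 6 ^+ n <= (1 - w 2 / 2) * K ->
  0 <= K -> forall m b, 0 < m -> m < 2 * r -> cube b m x0 -> cube b m y0 ->
  `|avg u b m - c| * m <= K * (eps * w m) * r.
Proof.
have r0' := r0; move=> KE K0 m b m0; have [j] := exists_dyadic_le r m0; elim: j m b m0 => [|j ih] m b m0.
  rewrite expr0 divr1 => rm m2r x0m y0m.
  have ew : 0 <= eps * w m by rewrite mulr_ge0 ?powR_ge0// ltW.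
  have h := avg_big_cube rm x0m y0m.
  have h3 : (3 * m / r) ^+ n <= 6 ^+ n.
    apply: lerXn2r; rewrite ?nnegrE//; first by apply: divr_ge0; lra.
    by rewrite ler_pdivrMr//; lra.
  have w2 : 0 <= w 2 by exact: powR_ge0.
  have h4 : `|avg u b m - c| <= 12 * 6 ^+ n * (eps * w m).
    by apply: le_trans h _; have := ler_wpM2r ew h3; lra.
  have K24 : 24 * 6 ^+ n <= K.
    by apply: le_trans KE _; have := mulr_ge0 w2 K0; lra.
  (* The 24 in [KE] is 12 times the 2 of [m < 2 * r]. *)
  apply: (@le_trans _ _ (12 * 6 ^+ n * (eps * w m) * (2 * r))).
    by apply: ler_pM h4 _ => //; lra.
  have := ler_wpM2r (mulr_ge0 ew (ltW r0)) K24.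
  by lra.
move=> rm m2r x0m y0m; have [mr|mr] := leP r m.
  apply: ih => //; apply: le_trans mr.
  by rewrite ler_pdivrMr ?exprn_gt0// ler_peMr ?(ltW r0)// exprn_ege1// ler1n.
have m2 : 0 < 2 * m by lra.
have sub := cube_double (a := b) (ltW m0).
have h1 : `|avg u b (2 * m) - c| * (2 * m) <= K * (eps * w (2 * m)) * r.
  apply: ih => //; [|lra|exact: sub|exact: sub].
  by rewrite -ler_pdivrMl// mulrC -mulrA -invfM -exprSr.
have h2 := avg_sub_le m0 m2 uI sub.
have h3 := osc m2 (sub _ x0m).
have w2 : w (2 * m) = w 2 * w m by rewrite powRM// ltW.
have h4 : `|avg u b m - c| <= `|avg u b (2 * m) - c| + 2 ^+ n * (eps * w (2 * m)).
  apply: le_trans (ler_distD (avg u b (2 * m)) _ _) _.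
  rewrite addrC lerD2l; apply: le_trans h2 _.
  have -> : 2 * m / m = 2 by rewrite mulfK// gt_eqF.
  by rewrite ler_wpM2l// exprn_ge0.
have W0 : 0 <= eps * w m by rewrite mulr_ge0 ?powR_ge0// ltW.
have v0 : 0 <= w 2 by exact: powR_ge0.
have v2 : w 2 <= 2.
  by case/andP: alpha01 => _ a1; rewrite ler1_powR// ler1n.
have e26 : (2 : R) ^+ n <= 6 ^+ n by apply: lerXn2r; rewrite ?nnegrE ?ler_nat.
have e0 : (0 : R) <= 2 ^+ n by apply: exprn_ge0.
move: h1 h4 KE e26 e0; rewrite w2 (_ : eps * (w 2 * w m) = w 2 * (eps * w m)); last by ring.
move: `|avg u b m - c| `|avg u b (2 * m) - c| (2 ^+ n) (6 ^+ n) W0 v0 v2.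
move: (eps * w m) (w 2) => W v A B p q W0 v0 v2 h1 h4 KE pq p0.
have h5 : p * (v * W) * m <= q * (2 * W) * r.
  apply: ler_pM => //; [by rewrite !mulr_ge0|exact: ltW| |exact: ltW].
  by apply: ler_pM => //; [by rewrite !mulr_ge0|rewrite ler_wpM2r].
(* By [h1] the doubled cube contributes at most [v / 2 * K * (W * r)]; by [h5] the passage to it
   adds at most [2 * q * (W * r)], which fits into the margin [(1 - v / 2) * K] given by [KE]. *)
have h6 : A * m <= (B + p * (v * W)) * m by rewrite ler_pM2r.
have Wr : 0 <= W * r by rewrite mulr_ge0// ltW.
have h7 := ler_wpM2r Wr KE.
have h8 : 0 <= q * (W * r) by rewrite mulr_ge0//; exact: le_trans pq.
lra.
Qed.

End average_growth.

(** A cube inside the ball of radius [r] only sees [u - F = c]. On other cubes the product rule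
    applies: beyond radius [2 * r] the cut-off vanishes; for [l >= r] the growth of the mean is
    offset by the small share of the cube where the cut-off lives; for [l < r] it is offset by the
    Lipschitz constant of the cut-off. *)
Lemma truncation (alpha : R) : 0 <= alpha < 1 -> exists2 C, 0 < C &
  forall u eps r, cube_integrable u -> 0 < eps -> 0 < r ->
  (forall a l, 0 < l -> r / 2 <= l \/ (forall x, cube a l x -> r / 2 < `|x|) ->
    mean_osc u a l <= eps * l `^ alpha) ->
  exists F, [/\ cube_integrable F, forall x, 2 * r < `|x| -> F x = 0 &
    forall a l, 0 < l ->
      mean_osc (fun x => u x - F x) a l <= C * eps * l `^ alpha].
Proof.
move=> /andP[al0 al1]; have al01 : 0 <= alpha <= 1 by rewrite al0 ltW.
set w := fun l => l `^ alpha.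
(* Strictness of [alpha < 1] enters here: [K] is a multiple of the inverse of
   [1 - 2 ^ (alpha - 1)]. *)
have w2 : w 2 < 2.
  rewrite lt_neqAle ler1_powR ?(ltW al1) ?ler1n// andbT.
  apply/eqP => /(congr1 (@ln R)); rewrite ln_powR.
  by have := ln_gt0 (ltr1n R 2); nra.
have th0 : 0 < 1 - w 2 / 2 by lra.
pose K : R := 24 * 6 ^+ n / (1 - w 2 / 2).
have K0 : 0 <= K by rewrite divr_ge0 ?(ltW th0)// mulr_ge0// exprn_ge0.
have KE : 24 * 6 ^+ n <= (1 - w 2 / 2) * K by rewrite [leRHS]mulrC mulfVK// gt_eqF.
(* For [l >= r], [P] bounds the growth factor [6 ^+ n + (3 * l / r) ^+ n] of the mean times the
   share [(4 * r / l) ^+ n] of the cut-off. *)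
pose P : R := 24 ^+ n + 12 ^+ n; have P0 : 0 <= P by rewrite addr_ge0// exprn_ge0.
exists (2 + 2 * K + 2 * (6 * P)); first by lra.
move=> u eps r uI eps0 r0 uosc.
have w0 l : 0 <= w l by exact: powR_ge0.
pose c := avg u (0 - const_mx r) (2 * r); pose v x := u x - c.
have vI : cube_integrable v by apply: cube_integrableB uI _; exact: cube_integrable_cst.
have avgv a l : 0 < l -> avg v a l = avg u a l - c.
  by move=> l0; rewrite avgB ?avg_cst//; exact: cube_integrable_cst.
pose phi x := 1 - cutoff r x.
have FI : cube_integrable (fun x => cutoff r x * v x).
  apply: cube_integrableM vI (measurable_cutoff r) _ => x.
  by rewrite ger0_norm ?cutoff_ge0 ?cutoff_le1.
exists (fun x => cutoff r x * v x); split => [//|x xr|a l l0].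
  by rewrite cutoff_out// mul0r.
have -> : mean_osc (fun x => u x - cutoff r x * v x) a l =
    mean_osc (fun x => phi x * v x) a l.
  have uFI := cube_integrableB uI FI.
  rewrite -(mean_osc_shift c a l0 uFI); apply: eq_mean_osc => x _.
  by rewrite /phi /v; ring.
have ew m : 0 <= eps * w m by rewrite mulr_ge0// ltW.
rewrite -mulrA -/(w l).
have [Qin|] := pselect (forall x, cube a l x -> `|x| <= r).
  rewrite (@eq_mean_osc _ _ _ (fun=> 0)) ?mean_osc_cst//.
    by apply: mulr_ge0; [lra|exact: ew].
  by move=> x /Qin xr; rewrite /phi cutoff_in// subrr mul0r.
move=> /existsNP[x0 /not_implyP[x0Q /negP]]; rewrite -ltNge => x0r.
(* Cubes meeting the complement of the ball of radius [r] are either large or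
   far away, so the oscillation of [u] is small on them. *)
have osc b m : 0 < m -> cube b m x0 -> mean_osc u b m <= eps * w m.
  move=> m0 x0b; apply: uosc => //; have [|rm] := leP (r / 2) m; first by left.
  right=> x xb; have := cube_dist (ltW m0) x0b xb.
  by have := ler_distD x x0 0; rewrite !subr0; lra.
(* The first term of the product rule is harmless. [B] measures the second one in units of
   [eps * w l], and [t] is the value with which [phi] is compared. *)
have main t B : `|avg v a l| * avg (fun x => `|phi x - t|) a l <= B * (eps * w l) ->
    B <= K + 6 * P ->
    mean_osc (fun x => phi x * v x) a l <= (2 + 2 * K + 2 * (6 * P)) * (eps * w l).
  move=> hB BK.
  apply: le_trans (mean_oscM_le t a l0 vI (measurable_cutoff_compl r)
    (cutoff_compl_le1 r)) _.
  have h1 : mean_osc v a l <= eps * w l by rewrite mean_osc_shift// osc.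
  have h2 := ler_wpM2r (ew l) BK.
  by lra.
have [far|] := pselect (forall x, cube a l x -> 2 * r < `|x|).
  apply: (main 1 0); last by lra.
  rewrite (@eq_avg _ _ (fun x => `|phi x - 1|) (fun=> 0)) ?avg_cst ?mulr0 ?mul0r//.
  by move=> x /far xr; rewrite /phi cutoff_out// subr0 subrr normr0.
move=> /existsNP[y0 /not_implyP[y0Q /negP]]; rewrite -leNgt => y0r.
have phiI : cube_integrable phi.
  exact: cube_integrable_bounded (measurable_cutoff_compl r) (cutoff_compl_le1 r).
have [rl|lr] := leP r l.
  apply: (main 1 (6 * P)); last by lra.
  have h := avg_big_cube al01 eps0 r0 uI y0r osc rl x0Q y0Q.
  rewrite -avgv// in h.
  have h' := ler_pM (normr_ge0 _) (avg_ge0 l0 (fun x _ => normr_ge0 _)) h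
    (avg_cutoff_le a r0 l0).
  apply: le_trans h' _; rewrite -/(w l).
  rewrite mulrAC [6 * P]mulrC -[leRHS]mulrA; apply: ler_wpM2r.
    by apply: mulr_ge0; [exact: ler0n|exact: ew].
  rewrite mulrDl -!exprMn /P.
  have -> : 3 * l / r * (4 * r / l) = 12 by field; rewrite !gt_eqF.
  rewrite lerD2r; apply: lerXn2r; rewrite ?nnegrE ?ler0n//.
    by apply: mulr_ge0 => //; apply: divr_ge0; [lra|exact: ltW].
  by rewrite mulrA ler_pdivrMr//; lra.
apply: (main (phi x0) K); last by lra.
have h1 : avg (fun x => `|phi x - phi x0|) a l <= l / r.
  apply: avg_le_cst => [//||x xQ]; first exact: cube_integrable_dev.
  rewrite /phi (_ : _ - _ = cutoff r x0 - cutoff r x); last by ring.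
  apply: le_trans (cutoff_lipschitz _ _ r0) _.
  by rewrite ler_pM2r ?invr_gt0//; exact: cube_dist (ltW l0) x0Q xQ.
apply: (@le_trans _ _ (`|avg v a l| * (l / r))); first by rewrite ler_wpM2l.
rewrite [leLHS]mulrA ler_pdivrMr// avgv//.
apply: avg_small_cube uI y0r osc _ KE K0 _ _ l0 _ x0Q y0Q => //.
by lra.
Qed.

End truncation.

(** * A smooth partition of unity on the line *)

Section smooth_step.
Variable R : realType.
Implicit Types (f g : R -> R) (k : nat) (t : R) (p : {poly R}).

(** The derivatives are existential witnesses, so stability under sums, products and inverses is an
    induction on [k] in which no iterated derivative is computed. *)
Fixpoint differentiable_upto k f : Prop :=
  if k is k'.+1 then
    exists2 g, forall t, is_derive t 1 f (g t) & differentiable_upto k' g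
  else True.

Lemma differentiable_upto_pred k f :
  differentiable_upto k.+1 f -> differentiable_upto k f.
Proof.
elim: k f => [//|k ih] f [g fg gk]; exists g => //; exact: ih.
Qed.

Lemma differentiable_uptoD k f g : differentiable_upto k f ->
  differentiable_upto k g -> differentiable_upto k (fun t => f t + g t).
Proof.
elim: k f g => [//|k ih] f g [f' ff' f'k] [g' gg' g'k].
exists (fun t => f' t + g' t); last exact: ih.
by move=> t; have := is_deriveD (ff' t) (gg' t).
Qed.

Lemma differentiable_uptoM k f g : differentiable_upto k f ->
  differentiable_upto k g -> differentiable_upto k (fun t => f t * g t).
Proof.
elim: k f g => [//|k ih] f g fk gk.
have := differentiable_upto_pred fk; have := differentiable_upto_pred gk.
case: fk gk => [f' ff' f'k] [g' gg' g'k] fk gk.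
exists (fun t => f t * g' t + g t * f' t).
  by move=> t; have := is_deriveM (ff' t) (gg' t).
by apply: differentiable_uptoD; exact: ih.
Qed.

Lemma differentiable_upto_cst k (c : R) : differentiable_upto k (fun=> c).
Proof.
elim: k c => [//|k ih] c; exists (fun=> 0); last exact: ih.
by move=> t; exact: is_derive_cst.
Qed.

Lemma differentiable_uptoV k f : (forall t, f t != 0) ->
  differentiable_upto k f -> differentiable_upto k (fun t => (f t)^-1).
Proof.
move=> f0; elim: k => [//|k ih] fk; have {}ih := ih (differentiable_upto_pred fk).
case: fk => f' ff' f'k; exists (fun t => -1 * ((f t)^-1 * (f t)^-1) * f' t).
  move=> t; have := is_deriveV (f0 t) (ff' t).
  by rewrite -exprVn expr2 mulN1r.
apply: differentiable_uptoM => //; apply: differentiable_uptoM; last exact: differentiable_uptoM.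
exact: differentiable_upto_cst.
Qed.

Lemma is_derive_affine f (c d t a : R) : is_derive (c * t + d) 1 f a ->
  is_derive t 1 (fun s => f (c * s + d)) (c * a).
Proof.
move=> fa; rewrite mulrC.
have h : is_derive t 1 (fun s : R => c * s + d) c.
  have := is_deriveD (is_deriveZ c (is_derive_id t (1 : R))) (is_derive_cst d t (1 : R)).
  by rewrite addr0 [_ *: _]mulr1.
exact: (@is_derive1_comp R f (fun s => c * s + d) t a c fa h).
Qed.

Lemma differentiable_upto_affine k f (c d : R) : differentiable_upto k f ->
  differentiable_upto k (fun t => f (c * t + d)).
Proof.
elim: k f => [//|k ih] f [f' ff' f'k]; exists (fun t => c * f' (c * t + d)).
  by move=> t; exact: is_derive_affine.
by apply: differentiable_uptoM; [exact: differentiable_upto_cst|exact: ih].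
Qed.

(** A family that contains the classical flat function exp(-1/t), at [p = 1], and is stable under
    differentiation. *)
Definition flat p t : R := if 0 < t then p.[t^-1] * expR (- t^-1) else 0.

Lemma expr_expRN_le k (s : R) : 0 <= s -> s ^+ k * expR (- s) <= k`!%:R.
Proof.
move=> s0; rewrite expRN ler_pdivrMr ?expR_gt0//.
case: k => [|k]; first by rewrite expr0 fact0 mul1r; apply: le_trans (expR_ge1Dx s); rewrite lerDl.
rewrite -ler_pdivrMl ?ltr0n ?fact_gt0//.
by apply: le_trans (expR_ge1Dxn k s0); rewrite mulrC lerDr.
Qed.

Lemma flat_le p : exists2 M, 0 <= M & forall t, `|flat p t| <= M * `|t|.
Proof.
exists (\sum_(i < size p) `|p`_i| * (i.+1)`!%:R); first exact: sumr_ge0.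
move=> t; rewrite /flat; case: ltP => t0; last by rewrite normr0 mulr_ge0// sumr_ge0.
rewrite (gtr0_norm t0) -ler_pdivrMr//; have s0 : 0 <= t^-1 by rewrite invr_ge0 ltW.
rewrite normrM (ger0_norm (expR_ge0 _)); move: (t^-1) s0 => s s0.
rewrite horner_coef mulrAC.
apply: le_trans (ler_wpM2r _ (ler_wpM2r s0 (ler_norm_sum _ _ _))) _; first exact: expR_ge0.
rewrite !mulr_suml; apply: ler_sum => i _.
rewrite normrM normrX (ger0_norm s0) -!mulrA ler_wpM2l// mulrA -exprSr.
exact: expr_expRN_le.
Qed.

Lemma flat0 p : flat p 0 = 0. Proof. by rewrite /flat ltxx. Qed.

(** With s = 1/t, d/dt is -s^2 d/ds, and the derivative of p(s) e^(-s) in s is (p' - p)(s) e^(-s).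
    At 0 the difference quotient of [flat p] is [flat (p * 'X)], which tends to 0. *)
Lemma flat_deriv p t : is_derive t 1 (flat p) (flat ('X^2 * (p - p^`())) t).
Proof.
have [t0|t0|->] := ltgtP t 0.
- have -> : flat ('X^2 * (p - p^`())) t = 0 by rewrite /flat ltNge (ltW t0).
  apply: (@near_eq_is_derive _ _ _ (cst 0)).
  near=> s; rewrite /flat ltNge ltW//=; near: s; exact: lt_nbhsl.
- have tn0 : t != 0 by rewrite gt_eqF.
  have hi : is_derive t 1 (fun s : R => s^-1) (- t ^- 2).
    by have := is_deriveV (f := id) tn0 (is_derive_id t 1); rewrite [_ *: _]mulr1.
  have hp := is_derive1_comp (is_derive_poly p t^-1) hi.
  have he := @is_derive1_comp R expR (fun s => - s^-1) t _ _
    (is_derive_expR (- t^-1)) (is_deriveN hi).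
  apply: (near_eq_is_derive _ (is_derive_eq (is_deriveM hp he) _)).
    near=> s; rewrite /flat ifT//; near: s; exact: lt_nbhsr.
  rewrite [RHS]/flat t0 !hornerE /= /GRing.scale/= exprVn; ring.
rewrite flat0; have [M M0 hM] := flat_le (p * 'X); have M1 : 0 < M + 1 by lra.
have cv : h^-1 *: ((flat p \o shift 0) (h *: 1) - flat p 0) @[h --> 0^'] --> (0 : R).
  apply/cvgrPdist_le => e e0; near=> h.
  rewrite /= flat0 subr0 sub0r normrN addr0 /GRing.scale/= mulr1.
  have -> : h^-1 * flat p h = flat (p * 'X) h.
    rewrite /flat; case: ifP => _; last by rewrite mulr0.
    by rewrite hornerMX mulrCA mulrA.
  apply: le_trans (hM h) _.
  apply: (@le_trans _ _ ((M + 1) * `|h|)); first by rewrite ler_wpM2r// lerDl.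
  rewrite -ler_pdivlMl//; near: h; apply: dnbhs0_le.
  by rewrite mulr_gt0// invr_gt0.
apply: DeriveDef; first by apply/cvg_ex; exists 0.
exact: cvg_lim cv.
Unshelve. all: by end_near. Qed.

Lemma differentiable_upto_flat k p : differentiable_upto k (flat p).
Proof.
elim: k p => [//|k ih] p; exists (flat ('X^2 * (p - p^`()))) => //.
exact: flat_deriv.
Qed.

Lemma flat1_ge0 t : 0 <= flat 1 t.
Proof. by rewrite /flat; case: ifP => // _; rewrite hornerE mul1r expR_ge0. Qed.

Lemma flat1_gt0 t : 0 < t -> 0 < flat 1 t.
Proof. by rewrite /flat => ->; rewrite hornerE mul1r expR_gt0. Qed.

(** The classical quotient f(t) / (f(t) + f(1 - t)); the argument is written in the affine form of
    [differentiable_upto_affine]. *)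
Definition step t : R := flat 1 t * (flat 1 t + flat 1 (-1 * t + 1))^-1.

Let den_gt0 t : 0 < flat 1 t + flat 1 (-1 * t + 1).
Proof.
have [t0|t0] := ltP 0 t; first by rewrite ltr_pwDl ?flat1_gt0 ?flat1_ge0.
by rewrite ltr_wpDl ?flat1_ge0// flat1_gt0//; lra.
Qed.

Lemma step_le0 t : t <= 0 -> step t = 0.
Proof. by move=> t0; rewrite /step {1}/flat ltNge t0 mul0r. Qed.

Lemma step_ge1 t : 1 <= t -> step t = 1.
Proof.
move=> t1; rewrite /step [flat 1 (_ + 1)]/flat ltNge (_ : -1 * t + 1 <= 0); last by lra.
by rewrite addr0 mulfV// gt_eqF// flat1_gt0//; lra.
Qed.

Lemma step_ge0 t : 0 <= step t.
Proof. by rewrite /step mulr_ge0 ?flat1_ge0// invr_ge0 ltW. Qed.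

Lemma step_le1 t : step t <= 1.
Proof. by rewrite /step ler_pdivrMr ?den_gt0// mul1r lerDl flat1_ge0. Qed.

Lemma differentiable_upto_step k : differentiable_upto k step.
Proof.
apply: differentiable_uptoM; first exact: differentiable_upto_flat.
apply: differentiable_uptoV => [t|]; first by rewrite gt_eqF.
apply: differentiable_uptoD; first exact: differentiable_upto_flat.
by apply: differentiable_upto_affine; exact: differentiable_upto_flat.
Qed.

(** A difference of translated steps, so that sums of integer translates telescope. *)
Definition hat t : R := step (1 * t + 1) + -1 * step t.

Lemma differentiable_upto_hat k : differentiable_upto k hat.
Proof.
apply: differentiable_uptoD; first exact/differentiable_upto_affine/differentiable_upto_step.
by apply: differentiable_uptoM; [exact: differentiable_upto_cst|exact: differentiable_upto_step].
Qed.

Lemma hatE t : hat t = step (t + 1) - step t.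
Proof. by rewrite /hat mul1r mulN1r. Qed.

Lemma hat_out t : 1 <= `|t| -> hat t = 0.
Proof.
rewrite ler_normr hatE => /orP[t1|t1].
  by rewrite !step_ge1 ?subrr//; lra.
by rewrite !step_le0 ?subrr//; lra.
Qed.

Lemma hat_norm_le1 t : `|hat t| <= 1.
Proof.
rewrite ler_norml hatE; have := step_ge0 t; have := step_le1 t.
have := step_ge0 (t + 1); have := step_le1 (t + 1).
by move=> ? ? ? ?; apply/andP; split; lra.
Qed.

Lemma sum_hat m t : \sum_(j < m) hat (t - j%:R) = step (t + 1) - step (t + 1 - m%:R).
Proof.
elim: m => [|m ih]; first by rewrite big_ord0 subr0 subrr.
rewrite big_ord_recr/= ih hatE (_ : m.+1%:R = m%:R + 1); last by rewrite natr1.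
have -> : t - m%:R + 1 = t + 1 - m%:R by ring.
have -> : t + 1 - (m%:R + 1) = t - m%:R by ring.
ring.
Qed.

(** The witnesses for different [k] are a priori unrelated. Uniqueness of the derivative identifies
    them with [derive1n], which yields one sequence for all orders. *)
Lemma smooth_family_exists f : (forall k, differentiable_upto k f) ->
  exists2 F : nat -> R -> R, F 0%N = f &
    forall k t, is_derive t 1 (F k) (F k.+1 t).
Proof.
move=> fk; exists (fun k => derive1n k f); [by []|move=> k].
have : forall m, differentiable_upto m (derive1n k f).
  elim: k => [//|k ih] m; have [g fg gm] := ih m.+1.
  rewrite derive1nS (_ : derive1 _ = g)//.
  by apply/funext => t; rewrite derive1E; case: (fg t) => _ ->.
move=> /(_ 1%N)[g fg _] t; rewrite derive1nS derive1E.
by apply: DeriveDef; case: (fg t).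
Qed.

End smooth_step.

(** * Smooth functions of several variables *)

Lemma compact_cube (R : realType) n (a : 'rV[R]_n) l : compact (cube a l).
Proof.
rewrite (_ : cube a l =
    [set v : 'rV[R]_n | forall i, `[a ord0 i, a ord0 i + l]%classic (v ord0 i)]).
  apply: (@rV_compact _ _ (fun i => `[a ord0 i, a ord0 i + l]%classic)) => i.
  exact: segment_compact.
by apply/seteqP; split => x /= xc i; have := xc i; rewrite in_itv.
Qed.

Section smooth_functions.
Variables (R : realType) (n : nat).
Implicit Types (f g h : 'rV[R]_n -> R) (x y z w : 'rV[R]_n) (i : 'I_n).
Local Notation e_ i := (delta_mx ord0 i : 'rV[R]_n).

(** A coinduction principle: smoothness follows from membership in any class of continuous,
    partially derivable functions that is stable under partial derivatives. *)
Lemma smooth_stable (S : set ('rV[R]_n -> R)) h : S h ->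
  (forall g, S g -> [/\ continuous g, forall i x, derivable g x (e_ i) &
     forall i, S (fun x => 'D_(e_ i) g x)]) ->
  smooth h.
Proof.
move=> Sh stab s; suff : S (iter_partial s h) by move=> /stab[].
by elim: s => [//|i s ih] /=; have [_ _] := stab _ ih; exact.
Qed.

Lemma smooth_continuous h : smooth h -> continuous h.
Proof. by move=> /(_ [::])[]. Qed.

Lemma smooth_derivable h i x : smooth h -> derivable h x (e_ i).
Proof. by move=> /(_ [::])[_]; exact. Qed.

Lemma smooth_partial h i : smooth h -> smooth (fun x => 'D_(e_ i) h x).
Proof. by move=> sh s; have := sh (rcons s i); rewrite /iter_partial foldr_rcons. Qed.

Lemma smoothD f g : smooth f -> smooth g -> smooth (fun x => f x + g x).
Proof.
move=> sf sg.
apply: (@smooth_stable [set h | exists f g, [/\ smooth f, smooth g & h = fun x => f x + g x]]).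
  by exists f, g.
move=> _ [{sf sg} {}f [{}g [sf sg ->]]].
have df i x : derivable f x (e_ i) by exact: smooth_derivable.
have dg i x : derivable g x (e_ i) by exact: smooth_derivable.
split=> [x|i x|i].
- exact: (continuousD (smooth_continuous sf (x := x)) (smooth_continuous sg (x := x))).
- exact: (derivableD (df i x) (dg i x)).
- exists (fun x => 'D_(e_ i) f x), (fun x => 'D_(e_ i) g x); split; try exact: smooth_partial.
  by apply/funext => x; exact: (deriveD (df i x) (dg i x)).
Qed.

Lemma is_derive_mull (c : R) f x v d :
  is_derive x v f d -> is_derive x v (fun y => c * f y) (c * d).
Proof.
by move=> fd; have := is_deriveM (is_derive_cst c x v) fd; rewrite scaler0 addr0.
Qed.

Lemma smoothZ (c : R) f : smooth f -> smooth (fun x => c * f x).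
Proof.
move=> sf.
apply: (@smooth_stable [set h | exists2 f, smooth f & h = fun x => c * f x]).
  by exists f.
move=> _ [{sf} {}f sf ->]; have df i x : derivable f x (e_ i) by exact: smooth_derivable.
split=> [x|i x|i].
- apply: (@continuousM _ _ (fun=> c) f x); last exact: smooth_continuous.
  exact: cst_continuous.
- by have [] := is_derive_mull c (derivableP (df i x)).
- exists (fun x => 'D_(e_ i) f x); first exact: smooth_partial.
  by apply/funext => x; have [] := is_derive_mull c (derivableP (df i x)).
Qed.

Lemma smooth0 : smooth (fun _ : 'rV[R]_n => 0 : R).
Proof.
apply: (@smooth_stable [set (fun=> 0)]) => // _ ->; split=> [x|i x|i].
- exact: cst_continuous.
- exact: derivable_cst.
- by apply/funext => x; exact: derive_cst.
Qed.

Lemma smooth_sum (I : Type) (r : seq I) (F : I -> 'rV[R]_n -> R) :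
  (forall k, smooth (F k)) -> smooth (fun x => \sum_(k <- r) F k x).
Proof.
move=> sF; elim: r => [|k r ih].
  by under eq_fun do rewrite big_nil; exact: smooth0.
by under eq_fun do rewrite big_cons; exact: (smoothD (sF k) ih).
Qed.

Lemma derive_line h x v : 'D_1 (fun t : R => h (t *: v + x)) 0 = 'D_v h x.
Proof.
have E : (fun k : R => k^-1 *: (((fun t => h (t *: v + x)) \o shift 0) (k *: 1) -
    h (0 *: v + x))) = (fun k => k^-1 *: ((h \o shift x) (k *: v) - h x)).
  by apply/funext => t; rewrite /= addr0 scale0r add0r [_%:A]mulr1.
by rewrite /derive E.
Qed.

Lemma is_derive_line h x v d :
  is_derive (0 : R) 1 (fun t : R => h (t *: v + x)) d -> is_derive x v h d.
Proof.
move=> [d1 d2]; apply: DeriveDef; first exact: (derivable1P h x v).2.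
by rewrite -d2 derive_line.
Qed.

Lemma is_derive_prod (F : 'I_n -> nat -> R -> R) (m : 'I_n -> nat) i x :
  (forall j k (t : R), is_derive t 1 (F j k) (F j k.+1 t)) ->
  is_derive x (e_ i) (fun x => \prod_j F j (m j) (x ord0 j))
    (\prod_j F j (m j + (j == i))%N (x ord0 j)).
Proof.
move=> dF; apply: is_derive_line.
pose C := \prod_(j | j != i) F j (m j) (x ord0 j).
rewrite (_ : (fun t => _) = (fun t => C * F i (m i) (1 * t + x ord0 i))); last first.
  apply/funext => t; rewrite (bigD1 i)//= mulrC; congr (_ * _).
    apply: eq_bigr => j ji; rewrite !mxE !eqxx/= (negbTE ji) mulr0 add0r//.
  by rewrite !mxE !eqxx/= mulr1 mul1r.
rewrite (bigD1 i)//= eqxx addn1.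
rewrite (eq_bigr (fun j => F j (m j) (x ord0 j))); last first.
  by move=> j /negbTE ->; rewrite addn0.
rewrite -/C mulrC.
apply: (is_deriveZ C).
rewrite -[X in is_derive _ _ _ X]mul1r; apply: is_derive_affine.
by rewrite mulr0 add0r; exact: dF.
Qed.

(** The stable class consists of the products of [F j (m j)] for all tuples of orders [m]; a partial
    derivative raises one order. *)
Lemma smooth_prod (F : 'I_n -> nat -> R -> R) :
  (forall j k (t : R), is_derive t 1 (F j k) (F j k.+1 t)) ->
  smooth (fun x => \prod_j F j 0%N (x ord0 j)).
Proof.
move=> dF; apply: (@smooth_stable [set h | exists m : 'I_n -> nat,
    h = fun x => \prod_j F j (m j) (x ord0 j)]); first by exists (fun=> 0%N).
move=> _ [m ->]; split=> [x|i x|i].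
- suff : forall r : seq 'I_n,
      continuous (fun y : 'rV[R]_n => \prod_(j <- r) F j (m j) (y ord0 j)) by exact.
  elim=> [|j r ih].
    rewrite (_ : (fun y => _) = fun=> 1); first by move=> ?; exact: cst_continuous.
    by apply/funext => y; rewrite big_nil.
  rewrite (_ : (fun y => _) = (fun y : 'rV[R]_n => F j (m j) (y ord0 j)) \*
      (fun y => \prod_(j <- r) F j (m j) (y ord0 j))); last first.
    by apply/funext => y; rewrite big_cons.
  move=> y; apply: continuousM; last exact: ih.
  apply: (@continuous_comp _ _ _ (fun x : 'rV[R]_n => x ord0 j)).
    exact: coord_continuous.
  apply/differentiable_continuous/derivable1_diffP.
  by have [] := dF j (m j) (y ord0 j).
- by have [] := is_derive_prod m i x dF.
- exists (fun j => (m j + (j == i))%N); apply/funext => x.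
  by have [] := is_derive_prod m i x dF.
Qed.

Section lipschitz.
Variables (h : 'rV[R]_n -> R) (d M : R).
Hypothesis dh : forall i x, derivable h x (e_ i).
Hypothesis hM : forall i x, `|x| <= d -> `|'D_(e_ i) h x| <= M.

Lemma is_derive_along i z (t : R) :
  is_derive t 1 (fun s : R => h (s *: e_ i + z)) ('D_(e_ i) h (t *: e_ i + z)).
Proof.
pose p := t *: e_ i + z.
have hp : derivable (fun s : R => h (s *: e_ i + p)) 0 1 by exact: (derivable1P h p (e_ i)).1.
have {}hp : is_derive (0 : R) 1 (fun s : R => h (s *: e_ i + p)) ('D_(e_ i) h p).
  by apply: DeriveDef => //; rewrite derive_line.
rewrite (_ : (fun s => _) = (fun s : R => h ((1 * s + (- t)) *: e_ i + p))); last first.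
  by apply/funext => s; rewrite /p mul1r addrA -scalerDl subrK.
rewrite -[X in is_derive _ _ _ X]mul1r.
apply: (@is_derive_affine R (fun s => h (s *: e_ i + p))).
by rewrite mul1r subrr.
Qed.

Lemma lipschitz_along i z s : 0 <= s ->
  (forall t, 0 <= t <= s -> `|t *: e_ i + z| <= d) ->
  `|h (s *: e_ i + z) - h z| <= M * s.
Proof.
move=> s0 zd.
have [c cs] : exists2 c, c \in `[0, s]%R &
    h (s *: e_ i + z) - h (0 *: e_ i + z) = 'D_(e_ i) h (c *: e_ i + z) * (s - 0).
  apply: (@MVT_segment _ (fun t => h (t *: e_ i + z))) => // [t _|].
    exact: is_derive_along.
  apply: continuous_subspaceT => t; apply/differentiable_continuous/derivable1_diffP.
  by case: (is_derive_along i z t).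
rewrite scale0r add0r subr0 => ->; rewrite normrM (ger0_norm s0) ler_wpM2r//.
by apply: hM; apply: zd; move: cs; rewrite in_itv.
Qed.

Lemma lipschitz_coord i z w : `|z| <= d -> `|w| <= d ->
  (forall j, j != i -> z ord0 j = w ord0 j) ->
  `|h z - h w| <= M * `|z ord0 i - w ord0 i|.
Proof.
wlog zw : z w / w ord0 i <= z ord0 i.
  move=> H zd wd zwj; have [|/ltW] := leP (w ord0 i) (z ord0 i); first by move=> /H; apply.
  by move=> /H; rewrite (distrC (h z)) (distrC (z ord0 i)); apply => // j /zwj.
move=> zd wd zwj; pose s := z ord0 i - w ord0 i.
have s0 : 0 <= s by rewrite subr_ge0.
have -> : z = s *: e_ i + w.
  apply/rowP => j; rewrite !mxE eqxx/=; have [->|ji] := eqVneq j i.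
    by rewrite mulr1 subrK.
  by rewrite mulr0 add0r zwj.
rewrite (_ : (s *: e_ i + w) ord0 i - w ord0 i = s); last first.
  by rewrite !mxE !eqxx mulr1 addrK.
rewrite (ger0_norm s0); apply: lipschitz_along => // t /andP[t0 ts].
have d0 : 0 <= d by exact: le_trans (normr_ge0 _) zd.
apply: normrV_le => // j; rewrite !mxE eqxx/=; have [->|ji] := eqVneq j i.
  have := le_trans (normrV_coord z i) zd; have := le_trans (normrV_coord w i) wd.
  move: ts t0; rewrite mulr1 /s.
  by rewrite !ler_norml => ? ? /andP[? ?] /andP[? ?]; apply/andP; split; lra.
by rewrite mulr0 add0r; exact: le_trans (normrV_coord w j) wd.
Qed.

(** Only partial derivatives are at hand, so [z] is changed into [w] one coordinate at a time, in
    [n] moves. The intermediate points stay in the ball because the norm is the maximum norm. *)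
Lemma lipschitz_ball z w : `|z| <= d -> `|w| <= d ->
  `|h z - h w| <= n%:R * M * `|z - w|.
Proof.
move=> zd wd; have d0 : 0 <= d by exact: le_trans (normr_ge0 _) zd.
(* In dimension 0 there is no partial derivative from which to deduce [0 <= M]. *)
have [n0|n1] := posnP n.
  rewrite (_ : z = w) ?subrr ?normr0 ?mulr0//.
  by apply/rowP => j; have := ltn_ord j; rewrite [X in (_ < X)%N -> _]n0 ltn0.
have M0 : 0 <= M by exact: le_trans (normr_ge0 _) (hM (Ordinal n1) zd).
pose p (k : nat) : 'rV[R]_n := \row_j (if (j < k)%N then w ord0 j else z ord0 j).
have pd k : `|p k| <= d.
  by apply: normrV_le => // j; rewrite mxE; case: ifP => _;
    [exact: le_trans (normrV_coord w j) wd|exact: le_trans (normrV_coord z j) zd].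
have : forall k, (k <= n)%N -> `|h z - h (p k)| <= k%:R * M * `|z - w|.
  elim=> [_|k ih kn].
    by rewrite (_ : p 0%N = z) ?subrr ?normr0 ?mul0r//; apply/rowP => j; rewrite mxE.
  apply: le_trans (ler_distD (h (p k)) _ _) _.
  rewrite -natr1 mulrDl mul1r mulrDl; apply: lerD; first exact: ih (ltnW kn).
  have := @lipschitz_coord (Ordinal kn) (p k) (p k.+1) (pd _) (pd _).
  rewrite !mxE/= ltnn ltnSn => H; apply: le_trans (H _) _.
    move=> j jk; rewrite !mxE (_ : (j < k.+1)%N = (j < k)%N)// ltnS leq_eqVlt.
    by have /negbTE -> : (j : nat) != k by move: jk; rewrite -val_eqE.
  rewrite ler_wpM2l//; have := normrV_coord (z - w) (Ordinal kn).
  by rewrite !mxE.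
move=> /(_ n (leqnn n)); rewrite (_ : p n = w)//.
by apply/rowP => j; rewrite mxE ltn_ord.
Qed.

End lipschitz.

Definition clamp (d : R) x : 'rV[R]_n :=
  \row_j (if x ord0 j < - d then - d else if d < x ord0 j then d else x ord0 j).

Lemma clamp_norm d x : 0 <= d -> `|clamp d x| <= d.
Proof.
move=> d0; apply: normrV_le => // j; rewrite mxE ler_norml.
by do ?(case: ifPn; rewrite -?leNgt => ?); apply/andP; split; lra.
Qed.

Lemma clamp_lipschitz d x y : 0 <= d -> `|clamp d x - clamp d y| <= `|x - y|.
Proof.
move=> d0; apply: normrV_le => // j; have := normrV_coord (x - y) j; rewrite !mxE.
move: (`|x - y|) (x ord0 j) (y ord0 j) => p q r.
rewrite !ler_norml => /andP[? ?].
by do ?(case: ifPn; rewrite -?leNgt => ?); apply/andP; split; lra.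
Qed.

Lemma clamp_id d x : `|x| <= d -> clamp d x = x.
Proof.
move=> xd; apply/rowP => j; have := le_trans (normrV_coord x j) xd; rewrite mxE ler_norml.
by move=> /andP[? ?]; do ?(case: ifPn; rewrite -?leNgt => ?); lra.
Qed.

Lemma clamp_out d x : 0 <= d -> d < `|x| -> `|clamp d x| = d.
Proof.
move=> d0 dx; apply/eqP; rewrite eq_le clamp_norm//=.
have [j dj] : exists j, d < `|x ord0 j|.
  apply: contrapT => /forallNP H; move: dx; rewrite ltNge => /negP; apply.
  by apply: normrV_le => // j; rewrite leNgt; apply/negP.
apply: le_trans (normrV_coord _ j); rewrite mxE.
case: ifPn => [_|]; first by rewrite normrN ler_norm.
rewrite -leNgt => h1; case: ifPn => [_|]; first by rewrite ler_norm.
by rewrite -leNgt => h2; move: dj; rewrite ltNge ler_norml h1 h2.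
Qed.

(** [h] factors through [clamp (d + 1)], which turns the estimate on a ball into a global one. The
    radius is [d + 1] because outside points are clamped to norm [d + 1], where [h] vanishes. *)
Lemma smooth_lipschitz h d : 0 <= d -> smooth h ->
  (forall x, d < `|x| -> h x = 0) ->
  exists2 L, 0 <= L & forall x y, `|h x - h y| <= L * `|x - y|.
Proof.
move=> d0 sh h0; have dh i x : derivable h x (e_ i) by exact: smooth_derivable.
have d1 : 0 <= d + 1 by lra.
have bnd i : exists M, forall x, `|x| <= d + 1 -> `|'D_(e_ i) h x| <= M.
  have [cD _] := sh [:: i].
  have : compact ((fun x => 'D_(e_ i) h x) @` cube (0 - const_mx (d + 1)) (2 * (d + 1))).
    apply: continuous_compact; last exact: compact_cube.
    by apply: continuous_subspaceT.
  move=> /compact_bounded[M [_ hM]]; exists (M + 1) => x xd.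
  apply: (hM (M + 1)); first by rewrite ltrDl.
  by exists x => //; apply/cube_center; rewrite ?subr0.
have {bnd}[Mi hMi] := choice bnd.
pose M := \sum_i `|Mi i|.
have hM i x : `|x| <= d + 1 -> `|'D_(e_ i) h x| <= M.
  move=> /hMi/le_trans; apply; apply: le_trans (ler_norm _) _.
  by rewrite /M (bigD1 i)//= lerDl sumr_ge0.
have M0 : 0 <= M by exact: sumr_ge0.
exists (n%:R * M); first by rewrite mulr_ge0.
have hc x : h x = h (clamp (d + 1) x).
  have [xd|xd] := leP `|x| (d + 1); first by rewrite clamp_id.
  by rewrite !h0// ?clamp_out//; lra.
move=> x y; rewrite (hc x) (hc y).
apply: le_trans (lipschitz_ball dh hM (clamp_norm _ d1) (clamp_norm _ d1)) _.
by rewrite ler_wpM2l ?mulr_ge0//; exact: clamp_lipschitz.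
Qed.

End smooth_functions.

(** * Tents on a grid: a partition of unity in n variables *)

Section tent.
Variables (R : realType) (n : nat).
Implicit Types (x y : 'rV[R]_n).

Definition tent x : R := \prod_j hat (x ord0 j).

Lemma smooth_tent_affine (c : R) (b : 'rV[R]_n) : smooth (fun x => tent (c *: (x - b))).
Proof.
have [F F0 dF] : exists2 F : 'I_n -> nat -> R -> R,
    forall j t, F j 0%N t = hat (c * t + - (c * b ord0 j)) &
    forall j k (t : R), is_derive t 1 (F j k) (F j k.+1 t).
  have H j : exists F : nat -> R -> R,
      (forall t, F 0%N t = hat (c * t + - (c * b ord0 j))) /\
      forall k (t : R), is_derive t 1 (F k) (F k.+1 t).
    have [|F F0 dF] := @smooth_family_exists R (fun t => hat (c * t + - (c * b ord0 j))).
      by move=> k; apply: differentiable_upto_affine; exact: differentiable_upto_hat.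
    by exists F; split => // t; rewrite F0.
  have [F HF] := choice H; exists F => j; first exact: (HF j).1.
  exact: (HF j).2.
rewrite (_ : (fun x => _) = (fun x => \prod_j F j 0%N (x ord0 j))); first exact: smooth_prod.
apply/funext => x; apply: eq_bigr => j _; rewrite F0 !mxE; congr hat; ring.
Qed.

Lemma smooth_tent : smooth tent.
Proof.
have := smooth_tent_affine 1 0; congr smooth.
by apply/funext => x; rewrite subr0 scale1r.
Qed.

Lemma tent_le1 x : `|tent x| <= 1.
Proof.
by rewrite /tent normr_prod; apply: prodr_ile1 => j _; rewrite normr_ge0 hat_norm_le1.
Qed.

Lemma tent_out x : 1 <= `|x| -> tent x = 0.
Proof.
move=> x1; have [j xj] : exists j, 1 <= `|x ord0 j|.
  apply: contrapT => /forallNP H.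
  have {}H j : `|x ord0 j| < 1 by rewrite ltNge; apply/negP.
  pose M := \big[Num.max/0]_j `|x ord0 j|.
  have M1 : M < 1 by apply: bigmax_lt.
  have : `|x| <= M.
    apply: normrV_le => [|j]; first exact: bigmax_ge_id.
    by have := @le_bigmax _ _ _ 0 (fun j => `|x ord0 j|) j.
  by move=> /(le_trans x1); rewrite leNgt M1.
by rewrite /tent (bigD1 j)//= hat_out// mul0r.
Qed.

Lemma tent_lipschitz : exists2 L, 0 <= L & forall x y, `|tent x - tent y| <= L * `|x - y|.
Proof.
apply: (smooth_lipschitz ler01 smooth_tent) => x x1; exact: tent_out (ltW x1).
Qed.

End tent.

Section grid.
Variables (R : realType) (n N : nat) (S0 dl : R).
Hypothesis dl0 : 0 < dl.
Implicit Types (x y : 'rV[R]_n) (k : {ffun 'I_n -> 'I_N}).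

Definition grid k : 'rV[R]_n := \row_j (- S0 + dl * (k j)%:R).

Definition grid_tent k x : R := tent (dl^-1 *: (x - grid k)).

Lemma grid_tent_neq0 k x : grid_tent k x != 0 -> `|grid k - x| < dl.
Proof.
apply: contraNT; rewrite -leNgt => xk; rewrite /grid_tent tent_out//.
by rewrite normrZ gtr0_norm ?invr_gt0// distrC ler_pdivlMl// mulr1.
Qed.

(** Distributivity turns the sum over multi-indices into a product of telescoping sums. With
    [t = (x_j + S0) / dl] in [[0, N - 1]], each is [step (t + 1) - step (t + 1 - N) = 1 - 0]. *)
Lemma sum_grid_tent x : `|x| <= S0 -> 2 * S0 <= dl * (N%:R - 1) ->
  \sum_k grid_tent k x = 1.
Proof.
move=> xS NS; transitivity (\sum_(k : {ffun 'I_n -> 'I_N}) \prod_j hat ((x ord0 j + S0) / dl - (k j)%:R)).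
  apply: eq_bigr => k _; apply: eq_bigr => j _; rewrite !mxE; congr hat.
  by field; rewrite gt_eqF.
rewrite -(bigA_distr_bigA (fun j (i : 'I_N) => hat ((x ord0 j + S0) / dl - i%:R))).
rewrite big1// => j _; rewrite sum_hat.
have := le_trans (normrV_coord x j) xS; rewrite ler_norml => /andP[x1 x2].
have t0 : 0 <= (x ord0 j + S0) / dl by rewrite divr_ge0 ?(ltW dl0)//; lra.
have tN : (x ord0 j + S0) / dl <= N%:R - 1 by rewrite ler_pdivrMr// mulrC; lra.
by rewrite step_ge1 ?step_le0 ?subr0//; lra.
Qed.

(** Measured in units of [dl], the indices lie in an open interval of length 4, hence differ by at
    most 3 and are told apart by their residues modulo 4. *)
Lemma grid_coord_inj (i j : 'I_N) (t : R) :
  `|- S0 + dl * i%:R - t| < 2 * dl -> `|- S0 + dl * j%:R - t| < 2 * dl ->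
  (i %% 4 = j %% 4)%N -> i = j.
Proof.
move=> hi hj ij; apply/val_inj => /=.
have key (a b : nat) : `|- S0 + dl * a%:R - t| < 2 * dl ->
    `|- S0 + dl * b%:R - t| < 2 * dl -> (a <= b)%N -> (b < a + 4)%N.
  rewrite !ltr_norml => /andP[? ?] /andP[? ?] _.
  rewrite -(ltr_nat R) natrD -(ltr_pM2l dl0); lra.
case: (leqP i j) => [h|/ltnW h].
  by have := key _ _ hi hj h; lia.
by have := key _ _ hj hi h; lia.
Qed.

Lemma card_grid_near x : (#|[pred k | (`|grid k - x| < 2 * dl)%R]| <= 4 ^ n)%N.
Proof.
pose g k : {ffun 'I_n -> 'I_4} := [ffun j => inord (k j %% 4)].
rewrite -[X in (_ <= X ^ _)%N](card_ord 4) -[X in (_ <= _ ^ X)%N](card_ord n) -card_ffun.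
rewrite -(@card_in_imset _ _ g); first exact: max_card.
move=> k k'; rewrite !inE => hk hk' /ffunP gkk'; apply/ffunP => j.
have coord (l : {ffun 'I_n -> 'I_N}) : `|grid l - x| < 2 * dl ->
    `|- S0 + dl * (l j)%:R - x ord0 j| < 2 * dl.
  by apply: le_lt_trans; have := normrV_coord (grid l - x) j; rewrite !mxE.
apply: (grid_coord_inj (coord _ hk) (coord _ hk')).
have := gkk' j; rewrite !ffunE => /(congr1 val) /=.
by rewrite !inordK// ltn_pmod.
Qed.

Lemma sum_grid_near x (A : {ffun 'I_n -> 'I_N} -> R) B : 0 <= B ->
  (forall k, A k != 0 -> `|grid k - x| < 2 * dl) ->
  (forall k, A k != 0 -> `|A k| <= B) ->
  `|\sum_k A k| <= 4 ^+ n * B.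
Proof.
move=> B0 Ax AB; rewrite (bigID (fun k => k \in [pred k | `|grid k - x| < 2 * dl]))/=.
rewrite [X in _ + X]big1 ?addr0; last first.
  by move=> k; rewrite inE; apply: contraNeq => /Ax.
apply: le_trans (ler_norm_sum _ _ _) _.
apply: (@le_trans _ _ (\sum_(k in [pred k | `|grid k - x| < 2 * dl]) B)).
  apply: ler_sum => k _; have [->|/AB//] := eqVneq (A k) 0; by rewrite normr0.
rewrite sumr_const -[leLHS]mulr_natl ler_wpM2r// -natrX ler_nat; exact: card_grid_near.
Qed.

End grid.

(** * Mollification *)

Section mollification.
Variables (R : realType) (n : nat) (alpha S dl eps L : R) (F : 'rV[R]_n -> R).
Hypotheses (alpha01 : 0 <= alpha <= 1) (S_gt0 : 0 < S) (dl0 : 0 < dl) (eps0 : 0 < eps).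
Hypotheses (FI : cube_integrable F) (F_out : forall x, S < `|x| -> F x = 0).
Hypothesis F_osc : forall a l, 0 < l -> l <= 8 * dl -> mean_osc F a l <= eps * l `^ alpha.
Hypotheses (L0 : 0 <= L) (tent_L : forall x y : 'rV[R]_n, `|tent x - tent y| <= L * `|x - y|).
Implicit Types (a x y : 'rV[R]_n).

(** If [|y| > S0] and [x] is within [2 * dl] of [y], the cube of half-side [4 * dl] about [x] misses
    the support of [F], since 2 + 4 < 7. *)
Let S0 := S + 7 * dl.
Let N := (Num.truncn (2 * S0 / dl)).+2.
Local Notation p := (@grid R n N S0 dl).
Local Notation eta := (@grid_tent R n N S0 dl).
Let c (k : {ffun 'I_n -> 'I_N}) := avg F (p k) dl.
(** Here [8 ^+ n] is the volume ratio of cubes of sides [8 * dl] and [dl]; the last factor 8 comes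
    from [(8 * dl) ^ alpha <= 8 * dl ^ alpha]. *)
Let E := 8 ^+ n.+1 * (eps * dl `^ alpha).
(** A local reference value: the cube of side [dl] at a grid point closer to [x] than [3 * dl] lies
    in this one. *)
Let cs x := avg F (x - const_mx (4 * dl)) (2 * (4 * dl)).

Definition mollified x := \sum_k c k * eta k x.

Let dl4 : 0 < 4 * dl. Proof. by rewrite mulr_gt0. Qed.
Let dl8 : 0 < 2 * (4 * dl). Proof. by rewrite mulr_gt0. Qed.

Let E_ge0 : 0 <= E.
Proof. by rewrite mulr_ge0 ?exprn_ge0// mulr_ge0 ?powR_ge0// ltW. Qed.

Lemma smooth_mollified : smooth mollified.
Proof. by apply: smooth_sum => k; apply: smoothZ; exact: smooth_tent_affine. Qed.

Lemma mollified_bounded x : `|mollified x| <= \sum_k `|c k|.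
Proof.
apply: le_trans (ler_norm_sum _ _ _) _; apply: ler_sum => k _.
by rewrite normrM ler_piMr// tent_le1.
Qed.

Lemma cube_integrable_mollified : cube_integrable mollified.
Proof.
apply: (cube_integrable_le (cube_integrable_cst _ (\sum_k `|c k|))) => [|x].
  by apply: continuous_rVleb; apply: smooth_continuous; exact: smooth_mollified.
apply: le_trans (mollified_bounded x) _; exact: ler_norm.
Qed.

Lemma mollified_out x : S0 + 2 * S0 + 3 * dl < `|x| -> mollified x = 0.
Proof.
have dl0' := dl0; have S_gt0' := S_gt0.
move=> xS; apply: big1 => k _; apply/eqP; rewrite mulf_eq0; apply/orP; right.
apply: contraTT xS => /(grid_tent_neq0 dl0) kx; rewrite -leNgt.
have gk : `|p k| <= S0 + 2 * S0 + 2 * dl.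
  apply: normrV_le => [|j]; first by rewrite /S0; lra.
  rewrite mxE; have kN : (k j)%:R <= 2 * S0 / dl + 1.
    apply: (@le_trans _ _ ((Num.truncn (2 * S0 / dl)).+1)%:R).
      by rewrite ler_nat -ltnS.
    rewrite -natr1 lerD2r truncn_le divr_ge0 ?(ltW dl0)//; rewrite /S0; lra.
  have kN' : dl * (k j)%:R <= 2 * S0 + dl.
    by rewrite -ler_pdivlMl// mulrDr mulVf ?gt_eqF// [_^-1 * _]mulrC.
  have k0 : 0 <= dl * (k j)%:R by rewrite mulr_ge0// ltW.
  by rewrite ler_norml; apply/andP; split; rewrite /S0 in kN' *; lra.
by have := ler_distD (p k) x 0; rewrite !subr0 distrC; lra.
Qed.

Let osc8 x : 8 ^+ n * mean_osc F (x - const_mx (4 * dl)) (2 * (4 * dl)) <= E.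
Proof.
rewrite /E exprSr -mulrA ler_wpM2l ?exprn_ge0//.
have e8 : 2 * (4 * dl) = 8 * dl by ring.
apply: le_trans (F_osc _ dl8 _) _; first by rewrite e8.
rewrite e8 mulrCA ler_wpM2l ?(ltW eps0)// powRM_le ?ler1n//.
Qed.

Let ratio8 : 2 * (4 * dl) / dl = 8.
Proof. by field; rewrite gt_eqF. Qed.

Let c_near x k : `|p k - x| < 3 * dl -> `|c k - cs x| <= E.
Proof.
move=> kx; apply: le_trans (osc8 x); rewrite -ratio8.
apply: avg_sub_le dl0 dl8 FI _ => y yk; apply/cube_center; first exact: ltW.
have h1 := cube_dist (ltW dl0) yk (cube_corner _ (ltW dl0)).
by have := ler_distD (p k) y x; move: kx h1; lra.
Qed.

(** The grid is finite, so the tents sum to 1 only on the ball of radius [S0]; outside it the factor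
    [cs x] vanishes instead. *)
Let cs_sum x y : `|y - x| <= 2 * dl -> cs x * (\sum_k eta k y - 1) = 0.
Proof.
have dl0' := dl0; have S_gt0' := S_gt0.
move=> yx; have [yS|yS] := leP `|y| S0.
  rewrite sum_grid_tent ?subrr ?mulr0//.
  rewrite /N (_ : _.+2%:R - 1 = (Num.truncn (2 * S0 / dl)).+1%:R); last by rewrite -natr1 addrK.
  by rewrite -ler_pdivrMl// mulrC; exact/ltW/truncnS_gt.
rewrite /cs (@eq_avg _ _ _ (fun=> 0)) ?avg_cst ?mul0r// => z.
move=> /(cube_center _ _ (ltW dl4)) zx; apply: F_out.
have := ler_distD x y 0; have := ler_distD z x 0; rewrite !subr0 (distrC x).
by move: yS; rewrite /S0; lra.
Qed.

Let mollified_sub x y :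
  \sum_k (c k - cs x) * eta k y = mollified y - cs x * \sum_k eta k y.
Proof. by under eq_bigr do rewrite mulrBl; rewrite sumrB -mulr_sumr. Qed.

Lemma mollified_near x y : `|y - x| <= 2 * dl -> `|mollified y - cs x| <= 4 ^+ n * E.
Proof.
move=> yx.
have -> : mollified y - cs x =
    \sum_k (c k - cs x) * eta k y + cs x * (\sum_k eta k y - 1).
  by rewrite mollified_sub; ring.
rewrite cs_sum// addr0.
have near k : eta k y != 0 -> `|p k - y| < dl by exact: grid_tent_neq0.
apply: (@sum_grid_near _ _ _ S0 dl dl0 y) => // k; rewrite mulf_eq0 negb_or => /andP[_ /near ky].
  by apply: lt_trans ky _; rewrite ltr_pMl// ltr1n.
rewrite normrM; apply: (@le_trans _ _ `|c k - cs x|).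
  by rewrite ler_piMr// tent_le1.
apply: c_near; have := ler_distD y (p k) x; move: ky yx; lra.
Qed.

(** Subtracting [cs x] from all weights changes nothing, by [cs_sum]. The bound thus involves the
    oscillation of [F] and not its size. *)
Lemma mollified_lipschitz x y : `|y - x| <= dl ->
  `|mollified y - mollified x| <= 4 ^+ n * (E * (L * (`|y - x| / dl))).
Proof.
have dl0' := dl0; move=> yx; have yx2 : `|y - x| <= 2 * dl by lra.
have xx2 : `|x - x| <= 2 * dl by rewrite subrr normr0; lra.
have -> : mollified y - mollified x = \sum_k (c k - cs x) * (eta k y - eta k x) +
    (cs x * (\sum_k eta k y - 1) - cs x * (\sum_k eta k x - 1)).
  under eq_bigr do rewrite mulrBr.
  rewrite sumrB !mollified_sub.
  by move: (cs x) (mollified x) (mollified y) (\sum_k _) (\sum_k _) => *; ring.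
rewrite !cs_sum// subrr addr0.
have near k : eta k y - eta k x != 0 -> `|p k - x| < 2 * dl.
  have [ky|/(grid_tent_neq0 dl0) ky _] := eqVneq (eta k y) 0.
    by rewrite ky sub0r oppr_eq0 => /(grid_tent_neq0 dl0); lra.
  by have := ler_distD y (p k) x; lra.
apply: (@sum_grid_near _ _ _ S0 dl dl0 x).
- by apply: mulr_ge0 => //; apply: mulr_ge0 => //; apply: divr_ge0 => //; exact: ltW.
- by move=> k; rewrite mulf_eq0 negb_or => /andP[_ /near].
- move=> k; rewrite mulf_eq0 negb_or => /andP[_ /near kx].
  rewrite normrM; apply: ler_pM => //; first by apply: c_near; lra.
  apply: le_trans (tent_L _ _) _; rewrite ler_wpM2l//.
  rewrite -scalerBr normrZ gtr0_norm ?invr_gt0// mulrC ler_pM2r ?invr_gt0//.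
  by rewrite opprB addrA subrK.
Qed.

Lemma mollified_osc a l : 0 < l -> mean_osc (fun x => F x - mollified x) a l <=
  (1 + 2 * (4 ^+ n * (8 ^+ n.+1 * L)) + 2 * ((1 + 4 ^+ n) * 8 ^+ n.+1)) * eps * l `^ alpha.
Proof.
have dl0' := dl0; have GI := cube_integrable_mollified.
move=> l0; have ew m : 0 <= eps * m `^ alpha by rewrite mulr_ge0 ?powR_ge0// ltW.
pose A : R := 4 ^+ n * (8 ^+ n.+1 * L); pose B : R := (1 + 4 ^+ n) * 8 ^+ n.+1.
have A0 : 0 <= A by rewrite !mulr_ge0// exprn_ge0.
have B0 : 0 <= B by rewrite mulr_ge0 ?addr_ge0// exprn_ge0.
rewrite -/A -/B -mulrA.
have [ld|dl_l] := leP l dl.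
  apply: le_trans (mean_oscB a l0 FI GI) _.
  have h1 : mean_osc F a l <= eps * l `^ alpha by apply: F_osc => //; lra.
  have h2 : mean_osc mollified a l <= 2 * (A * (eps * l `^ alpha)).
    apply: le_trans (mean_osc_le (mollified a) a l0 GI) _.
    rewrite ler_wpM2l//.
    apply: avg_le_cst => [//||x xa]; first exact: cube_integrable_dev.
    have xl := cube_dist (ltW l0) xa (cube_corner a (ltW l0)).
    apply: le_trans (mollified_lipschitz (le_trans xl ld)) _.
    rewrite /A -mulrA ler_wpM2l ?exprn_ge0// /E -!mulrA ler_wpM2l ?exprn_ge0//.
    have -> : eps * (dl `^ alpha * (L * (`|x - a| / dl))) =
      L * (eps * (`|x - a| * dl `^ alpha / dl)) by ring.
    rewrite ler_wpM2l// ler_wpM2l ?(ltW eps0)// ler_pdivrMr//.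
    rewrite [leRHS]mulrC; apply: le_trans (powR_ratio alpha01 l0 ld).
    by rewrite ler_wpM2r ?powR_ge0.
  have := mulr_ge0 B0 (ew l); lra.
(* Rounding down gives cells of side [s = l / m] between [dl] and [2 * dl]. *)
pose m := Num.truncn (l / dl).
have ldl : 1 < l / dl by rewrite ltr_pdivlMr// mul1r.
have /andP[m1 m2] : m%:R <= l / dl < m.+1%:R by apply: truncn_itv; lra.
have m0 : (0 < m)%N.
  by rewrite lt0n; apply/eqP => m0; move: m2; rewrite m0; lra.
have mR0 : (0 : R) < m%:R by rewrite ltr0n.
pose s := l / m%:R.
have s0 : 0 < s by rewrite divr_gt0.
have sdl : dl <= s.
  by rewrite /s ler_pdivlMr// mulrC -ler_pdivlMr.
have s2dl : s <= 2 * dl.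
  rewrite /s ler_pdivrMr// -mulrA [dl * _]mulrC mulrA -ler_pdivrMr//.
  apply: le_trans (ltW m2) _; rewrite -natrM ler_nat.
  by rewrite mul2n -addnn -[m.+1]addn1 leq_add2l.
have lE : l = m%:R * s by rewrite /s mulrC mulfVK// gt_eqF.
have FGI := cube_integrableB FI GI.
(* At scales above [dl] the difference is itself small in mean on every cell, so it is compared with
   the constant 0. *)
apply: le_trans (mean_osc_le 0 a l0 FGI) _.
have devI := cube_integrable_dev 0 FGI.
suff : avg (fun x => `|F x - mollified x - 0|) a (m%:R * s) <= (1 + 4 ^+ n) * E.
  rewrite -lE => h; have h3 : E <= 8 ^+ n.+1 * (eps * l `^ alpha).
    rewrite /E ler_wpM2l ?exprn_ge0// ler_wpM2l ?(ltW eps0)//.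
    by apply: le_powR_l => //; exact: ltW.
  have h4 : (1 + 4 ^+ n) * E <= B * (eps * l `^ alpha).
    by rewrite /B -mulrA ler_wpM2l// addr_ge0// exprn_ge0.
  by move: (mulr_ge0 A0 (ew l)) (ew l) h h3 h4; lra.
apply: (avg_split s0 m0 (cube_integrable_dev 0 FGI)) => // k.
set b := a + _.
apply: (@le_trans _ _ (avg (fun x => `|F x - cs b| + `|mollified x - cs b|) b s)).
  apply: le_avg s0 devI _ _ => [|x _].
    by apply: cube_integrableD; exact: cube_integrable_dev.
  rewrite subr0 (_ : _ - _ = (F x - cs b) - (mollified x - cs b)); last by ring.
  exact: ler_normB.
rewrite avgD; [|exact: s0|exact: cube_integrable_dev|exact: cube_integrable_dev].
have cb : cube b s `<=` cube (b - const_mx (4 * dl)) (2 * (4 * dl)).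
  move=> x xb; apply/cube_center; first exact: ltW.
  by have := cube_dist (ltW s0) xb (cube_corner b (ltW s0)); lra.
rewrite mulrDl mul1r; apply: lerD.
  apply: le_trans (osc8 b).
  apply: (@le_trans _ _ ((2 * (4 * dl) / s) ^+ n * mean_osc F (b - const_mx (4 * dl)) (2 * (4 * dl)))).
    apply: avg_le_cube s0 dl8 _ _ _ => [|//|x /cb//].
    exact: cube_integrable_dev.
  rewrite ler_wpM2r ?mean_osc_ge0//; apply: lerXn2r; rewrite ?nnegrE ?ler0n//.
    by rewrite divr_ge0 ?(ltW dl8) ?(ltW s0).
  by rewrite ler_pdivrMr//; lra.
apply: avg_le_cst => [//||x xb]; first exact: cube_integrable_dev.
apply: mollified_near.
by have := cube_dist (ltW s0) xb (cube_corner b (ltW s0)); lra.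
Qed.

End mollification.

(** * Vanishing oscillation of real functions *)

Lemma minn_succ i j : (minn i j <= minn i j.+1 <= (minn i j).+1)%N.
Proof. by apply/andP; split; lia. Qed.

Section vanishing.
Variables (R : realType) (n : nat).
Implicit Types (u G : 'rV[R]_n -> R) (a x y : 'rV[R]_n) (alpha e l d : R).

Definition vanishing_small alpha u := forall e, 0 < e -> exists2 d, 0 < d &
  forall a l, 0 < l -> l < d -> mean_osc u a l <= e * l `^ alpha.

Definition vanishing_large alpha u := forall e, 0 < e -> exists d,
  forall a l, 0 < l -> d < l -> mean_osc u a l <= e * l `^ alpha.

Definition vanishing_far alpha u := forall e, 0 < e -> exists d,
  forall a l, 0 < l -> (forall x, cube a l x -> d < `|x|) ->
    mean_osc u a l <= e * l `^ alpha.

Lemma smooth_approximation alpha u : 0 <= alpha < 1 -> cube_integrable u ->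
  vanishing_small alpha u -> vanishing_large alpha u -> vanishing_far alpha u ->
  forall e, 0 < e -> exists G, [/\ smooth G,
    exists T, forall x, T < `|x| -> G x = 0 &
    forall a l, 0 < l -> mean_osc (fun x => u x - G x) a l <= e * l `^ alpha].
Proof.
move=> al01 uI usm ula ufa e e0.
have [C C0 trunc] := @truncation R n alpha al01.
have [L L0 tL] := tent_lipschitz R n.
pose M : R := 1 + 2 * (4 ^+ n * (8 ^+ n.+1 * L)) + 2 * ((1 + 4 ^+ n) * 8 ^+ n.+1).
have M0 : 0 <= M.
  by apply: addr_ge0; [apply: addr_ge0 => //|]; rewrite !mulr_ge0 ?addr_ge0 ?exprn_ge0.
have C1 : 0 < 1 + C by rewrite addr_gt0.
have K0 : 0 < C + M * (1 + C) by rewrite ltr_pwDl// mulr_ge0// ltW.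
(* Truncation costs [C * eps]. Then [F] oscillates by [(1 + C) * eps] at small scales, and the grid
   sum multiplies this by [M]. *)
pose eps := e / (C + M * (1 + C)).
have eps0 : 0 < eps by rewrite divr_gt0.
have [d d0 hd] := usm _ eps0.
have [d1 hd1] := ula _ eps0; have [d2 hd2] := ufa _ eps0.
pose r := 2 * (`|d1| + `|d2| + 1).
have d1l := ler_norm d1; have d2l := ler_norm d2.
have n1 := normr_ge0 d1; have n2 := normr_ge0 d2.
have r0 : 0 < r by rewrite mulr_gt0// addr_ge0_gt0//; apply: addr_ge0.
have r2 : r / 2 = `|d1| + `|d2| + 1 by rewrite /r mulrAC mulfV ?mul1r.
have [|F [FI F0 Fosc]] := trunc u eps r uI eps0 r0.
  move=> a l l0 [rl|far]; first by apply: hd1 => //; lra.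
  by apply: hd2 => // x /far; apply: le_lt_trans; lra.
have uFI := cube_integrableB uI FI.
have al01' : 0 <= alpha <= 1 by case/andP: al01 => -> /ltW ->.
(* With mesh [d / 16] the cubes used by the grid sum have side at most [d / 2], below [d]. *)
have Fsm a l : 0 < l -> l <= 8 * (d / 16) -> mean_osc F a l <= (1 + C) * eps * l `^ alpha.
  move=> l0 ld; rewrite (@eq_mean_osc _ _ _ (fun x => u x - (u x - F x))); last first.
    by move=> x _; rewrite opprB addrCA subrr addr0.
  apply: le_trans (mean_oscB a l0 uI uFI) _.
  rewrite 2!mulrDl mul1r; apply: lerD; last exact: Fosc.
  by apply: hd => //; lra.
have d16 : 0 < d / 16 by rewrite divr_gt0.
have r20 : 0 < 2 * r by rewrite mulr_gt0.
have Ceps : 0 < (1 + C) * eps by rewrite mulr_gt0.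
pose G := mollified (2 * r) (d / 16) F.
have Gosc := mollified_osc al01' r20 d16 Ceps FI F0 Fsm L0 tL.
exists G; split; first exact: smooth_mollified.
  by eexists => x; exact: (@mollified_out _ _ _ _ F r20 d16 x).
move=> a l l0; have GI : cube_integrable G by exact: cube_integrable_mollified.
rewrite (@eq_mean_osc _ _ _ (fun x => (u x - F x) + (F x - G x))); last first.
  by move=> x _; rewrite addrA subrK.
apply: le_trans (mean_oscD a l0 uFI (cube_integrableB FI GI)) _.
apply: le_trans (lerD (Fosc a l l0) (Gosc a l l0)) _.
have -> : e = C * eps + M * ((1 + C) * eps).
  by rewrite [M * _]mulrA -mulrDl /eps mulrCA mulfV ?mulr1// gt_eqF.
by rewrite [leRHS]mulrDl.
Qed.

Section smooth_vanishing.
Variables (alpha T : R) (G : 'rV[R]_n -> R).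
Hypotheses (sG : smooth G) (T0 : 0 < T) (GT : forall x, T < `|x| -> G x = 0).

Lemma smooth_bounded : exists2 B, 0 <= B & forall x, `|G x| <= B.
Proof.
have : compact (G @` cube (0 - const_mx T) (2 * T)).
  apply: continuous_compact; last exact: compact_cube.
  by apply: continuous_subspaceT; exact: smooth_continuous.
move=> /compact_bounded[M [_ hM]]; exists (`|M| + 1); first by rewrite addr_ge0.
move=> x; have [xT|xT] := leP `|x| T; last by rewrite GT// normr0 addr_ge0.
apply: (hM (`|M| + 1)); first by rewrite ltr_pwDr// ler_norm.
by exists x => //; apply/cube_center; rewrite ?subr0// ltW.
Qed.

Lemma cube_integrable_smooth : cube_integrable G.
Proof.
have [B B0 GB] := smooth_bounded.
apply: (cube_integrable_le (cube_integrable_cst _ B)) => [|x].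
  by apply: continuous_rVleb; exact: smooth_continuous.
by rewrite [leRHS]ger0_norm.
Qed.

Lemma mean_osc_smooth : exists2 L, 0 <= L & forall a l, 0 < l -> mean_osc G a l <= L * l.
Proof.
have [L L0 GL] := smooth_lipschitz (ltW T0) sG GT.
exists (2 * L) => [|a l l0]; first by rewrite mulr_ge0.
have GI := cube_integrable_smooth.
apply: le_trans (mean_osc_le (G a) a l0 GI) _; rewrite -mulrA ler_wpM2l//.
apply: avg_le_cst => [//||x xa]; first exact: cube_integrable_dev.
apply: le_trans (GL _ _) _; rewrite ler_wpM2l//.
exact: (cube_dist (ltW l0) xa (cube_corner a (ltW l0))).
Qed.

Lemma smooth_vanishing_small : alpha < 1 -> vanishing_small alpha G.
Proof.
move=> al1 e e0; have [L L0 GL] := mean_osc_smooth.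
have b0 : 0 < 1 - alpha by rewrite subr_gt0.
have L1 : 0 < L + 1 by rewrite ltr_wpDl.
have eL : 0 < e / (L + 1) by rewrite divr_gt0.
(* This bound solves [(L + 1) * d ^ (1 - alpha) = e]. *)
exists ((e / (L + 1)) `^ (1 - alpha)^-1) => [|a l l0 ld]; first exact: powR_gt0.
apply: le_trans (GL a l l0) _.
have {1}-> : l = l `^ (1 - alpha) * l `^ alpha.
  by rewrite -powRD ?subrK ?powRr1 ?(ltW l0)// gt_eqF ?implybT.
rewrite mulrA ler_wpM2r ?powR_ge0//.
apply: (@le_trans _ _ ((L + 1) * l `^ (1 - alpha))).
  by rewrite ler_wpM2r ?powR_ge0// lerDl.
rewrite -ler_pdivlMl// [_^-1 * _]mulrC.
have -> : e / (L + 1) = ((e / (L + 1)) `^ (1 - alpha)^-1) `^ (1 - alpha).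
  by rewrite -powRrM mulVf ?powRr1 ?(ltW eL)// gt_eqF.
by rewrite ge0_ler_powR ?nnegrE ?powR_ge0 ?(ltW b0) ?(ltW l0) ?(ltW ld).
Qed.

(** The integral of [|G|] is fixed, so its averages decay at least like [1 / l], while the weight is
    at least 1 once [l >= 1]. *)
Lemma smooth_vanishing_large : (0 < n)%N -> 0 <= alpha -> vanishing_large alpha G.
Proof.
move=> n0 al0 e e0; have GI := cube_integrable_smooth.
have nGI := cube_integrable_norm GI.
pose B := avg (fun x => `|G x|) (0 - const_mx T) (2 * T).
have T2 : 0 < 2 * T by rewrite mulr_gt0.
have B0 : 0 <= B by apply: avg_ge0.
exists (2 * T + 1 + 4 * T * B / e) => a l l0 dl.
have TB : 0 <= 4 * T * B / e by rewrite divr_ge0 ?(ltW e0)// mulr_ge0// mulr_ge0// ltW.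
apply: le_trans (mean_osc_le 0 a l0 GI) _.
rewrite (@eq_avg _ _ (fun x => `|G x - 0|) (fun x => `|G x|)); last first.
  by move=> x _; rewrite subr0.
have h : avg (fun x => `|G x|) a l <= (2 * T / l) ^+ n * B.
  apply: avg_le_cube => [//|//||//|x _].
    exact: nGI.
  move=> Gx; apply/cube_center; first exact: ltW.
  by rewrite subr0 leNgt; apply: contra Gx => /GT ->; rewrite normr0.
have Tl : 0 <= 2 * T / l by rewrite divr_ge0 ?(ltW T2) ?(ltW l0).
have Tl1 : 2 * T / l <= 1 by rewrite ler_pdivrMr// mul1r; lra.
have h2 : (2 * T / l) ^+ n <= 2 * T / l by rewrite ler_iXnr.
have h3 : avg (fun x => `|G x|) a l <= 2 * T / l * B.
  by apply: le_trans h _; rewrite ler_wpM2r.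
have l1 : 1 <= l `^ alpha.
  by have := @ler_powR _ l; move=> /(_ ltac:(lra) _ _ al0); rewrite powRr0.
apply: (@le_trans _ _ e); last by rewrite ler_peMr// ltW.
apply: (@le_trans _ _ (4 * T * B / l)).
  have -> : 4 * T * B / l = 2 * (2 * T / l * B) by field; rewrite gt_eqF.
  by rewrite ler_wpM2l.
rewrite ler_pdivrMr// -ler_pdivrMl// [_^-1 * _]mulrC; lra.
Qed.

Lemma smooth_vanishing_far : vanishing_far alpha G.
Proof.
move=> e e0; exists T => a l l0 far.
rewrite (@eq_mean_osc _ _ _ (fun=> 0)) ?mean_osc_cst//; last by move=> x /far/GT.
by rewrite mulr_ge0 ?powR_ge0// ltW.
Qed.

End smooth_vanishing.

(* Subdivide the cube into [m ^ n] cubes of side [s = l / m]: neighbouring means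
   differ by a constant times [eps * s], hence any two of them by a constant
   times [m * eps * s = eps * l]. *)
Lemma vanishing_small1 u a l : cube_integrable u -> vanishing_small 1 u ->
  0 < l -> mean_osc u a l = 0.
Proof.
move=> uI usm l0; apply/eqP; rewrite eq_le mean_osc_ge0// andbT.
apply/ler_addgt0Pl => e e0; rewrite addr0.
(* The 2 is that of [mean_osc_le]; the 1 accounts for the oscillation on one subcube, and
   [2 ^+ n * 4] for the chain of means. *)
pose K : R := 2 * ((1 + 2 ^+ n * 4) * l).
have K0 : 0 < K by rewrite !mulr_gt0// addr_gt0// mulr_gt0// exprn_gt0.
pose eps := e / K; have eps0 : 0 < eps by rewrite divr_gt0.
have [d d0 hd] := usm _ eps0.
pose m := (Num.truncn (2 * l / d)).+1.
have mR : (0 : R) < m%:R by rewrite ltr0n.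
pose s := l / m%:R.
have s0 : 0 < s by rewrite divr_gt0.
have sd : 2 * s < d.
  rewrite /s mulrA ltr_pdivrMr// -ltr_pdivrMl// [_^-1 * _]mulrC; exact: truncnS_gt.
have lE : l = m%:R * s by rewrite /s mulrC mulfVK// gt_eqF.
have osc b t : 0 < t -> t <= 2 * s -> mean_osc u b t <= eps * t.
  move=> t0 ts; have := hd b t t0 (le_lt_trans ts sd).
  by rewrite powRr1// ltW.
have s20 : 0 < 2 * s by rewrite mulr_gt0.
pose c := avg u a s.
have uIc := cube_integrable_dev c uI.
apply: le_trans (mean_osc_le c a l0 uI) _.
have -> : e = 2 * ((eps + 2 ^+ n * 4 * eps) * l).
  by rewrite /eps -[X in X + _]mul1r -mulrDl mulrAC mulrA -/K [RHS]mulrC mulfVK// gt_eqF.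
rewrite ler_wpM2l//.
suff H (k : {ffun 'I_n -> 'I_m}) : avg (fun x => `|u x - c|) (a + \row_i ((k i)%:R * s)) s <=
    (eps + 2 ^+ n * 4 * eps) * l.
  by rewrite [X in avg _ _ X]lE; apply: (avg_split s0 _ uIc).
(* All coordinates advance together and each stops at its own [k i], so [m] steps suffice.
   Consecutive cubes lie in the double of the first; two comparisons with it, each costing
   [2 ^+ n * eps * (2 * s)], give the factor 4. *)
pose q j := a + \row_i ((minn (k i) j)%:R * s).
have qm : q m = a + \row_i ((k i)%:R * s).
  by congr (_ + _); apply/rowP => i; rewrite !mxE (minn_idPl _)// ltnW.
have q0 : q 0%N = a by apply/rowP => i; rewrite !mxE minn0 mul0r addr0.
have step j : `|avg u (q j.+1) s - avg u (q j) s| <= 2 ^+ n * 4 * eps * s.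
  have sub0 : cube (q j) s `<=` cube (q j) (2 * s) by exact/cube_double/ltW.
  have sub1 : cube (q j.+1) s `<=` cube (q j) (2 * s).
    move=> x xq i; have := xq i; rewrite !mxE => /andP[h1 h2].
    have /andP[g1n g2n] := minn_succ (k i) j.
    have g1 : ((minn (k i) j)%:R : R) <= (minn (k i) j.+1)%:R by rewrite ler_nat.
    have g2 : ((minn (k i) j.+1)%:R : R) <= (minn (k i) j)%:R + 1 by rewrite natr1 ler_nat.
    have g1' := ler_wpM2r (ltW s0) g1; have g2' := ler_wpM2r (ltW s0) g2.
    by apply/andP; split; lra.
  have r2 : 2 * s / s = 2 by rewrite mulfK// gt_eqF.
  have h0 := avg_sub_le s0 s20 uI sub0; have h1 := avg_sub_le s0 s20 uI sub1.
  rewrite r2 in h0 h1; have ho := osc (q j) (2 * s) s20 (lexx _).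
  apply: le_trans (ler_distD (avg u (q j) (2 * s)) _ _) _.
  rewrite [`|avg u (q j) (2 * s) - _|]distrC.
  apply: le_trans (lerD h1 h0) _.
  have := ler_wpM2l (exprn_ge0 n (ler0n R 2)) ho; lra.
have chain j : `|avg u (q j) s - c| <= j%:R * (2 ^+ n * 4 * eps * s).
  elim: j => [|j ih]; first by rewrite q0 subrr normr0 mul0r.
  apply: le_trans (ler_distD (avg u (q j) s) _ _) _.
  by rewrite -natr1 mulrDl mul1r addrC lerD.
have sl : s <= l by rewrite /s ler_pdivrMr// ler_peMr ?(ltW l0)// ler1n.
rewrite -qm; apply: (@le_trans _ _
  (avg (fun x => `|u x - avg u (q m) s| + `|avg u (q m) s - c|) (q m) s)).
  apply: le_avg => [//||| x _]; first exact: cube_integrable_dev.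
    apply: cube_integrableD; first exact: cube_integrable_dev.
    exact: cube_integrable_cst.
  exact: ler_distD.
rewrite avgD; [|exact: s0|exact: cube_integrable_dev|exact: cube_integrable_cst].
rewrite avg_cst// mulrDl; apply: lerD.
  have ss : s <= 2 * s by lra.
  by apply: le_trans (osc (q m) s s0 ss) _; rewrite ler_wpM2l// ltW.
by apply: le_trans (chain m) _; rewrite mulrCA -lE.
Qed.

End vanishing.

(** * Real and imaginary parts *)

Section complex_parts.
Variables (R : realType) (n : nat).
Local Notation leb := (@lebesgue_rV R n).
Local Notation normc := Normc.normc.
Local Notation Re := complex.Re.
Local Notation Im := complex.Im.
Implicit Types (f g : 'rV[R]_n -> R[i]) (z : R[i]) (a x y : 'rV[R]_n) (l : R).

Lemma Re_le_normc z : `|Re z| <= normc z.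
Proof.
case: z => a b /=; rewrite -sqrtr_sqr; apply: ler_wsqrtr.
by rewrite lerDl sqr_ge0.
Qed.

Lemma Im_le_normc z : `|Im z| <= normc z.
Proof.
case: z => a b /=; rewrite -sqrtr_sqr; apply: ler_wsqrtr.
by rewrite lerDr sqr_ge0.
Qed.

Lemma normc_le_ReIm z : normc z <= `|Re z| + `|Im z|.
Proof.
case: z => a b /=; rewrite -[leRHS]ger0_norm ?addr_ge0// -sqrtr_sqr.
apply: ler_wsqrtr; rewrite sqrrD !real_normK ?num_real//.
by rewrite -addrA lerD2l lerDr mulrn_wge0// mulr_ge0.
Qed.

Lemma normc_ge0 z : 0 <= normc z.
Proof. exact: le_trans (normr_ge0 _) (Re_le_normc z). Qed.

Lemma ReB (z1 z2 : R[i]) : Re (z1 - z2) = Re z1 - Re z2.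
Proof. by case: z1 z2 => [? ?] [? ?]. Qed.

Lemma ImB (z1 z2 : R[i]) : Im (z1 - z2) = Im z1 - Im z2.
Proof. by case: z1 z2 => [? ?] [? ?]. Qed.

Lemma measurable_normc f :
  measurable_fun [set: rVleb R n] (fun x => Re (f x)) ->
  measurable_fun [set: rVleb R n] (fun x => Im (f x)) ->
  measurable_fun [set: rVleb R n] (fun x => normc (f x)).
Proof.
move=> mRe mIm.
rewrite (_ : (fun x => _) = Num.sqrt \o (fun x => Re (f x) ^+ 2 + Im (f x) ^+ 2)).
  apply: measurableT_comp.
    by apply: continuous_measurable_fun; exact: sqrt_continuous.
  by apply: measurable_funD; exact: measurable_funX.
by apply/funext => x /=; case: (f x).
Qed.

Lemma compact_in_cube (K : set 'rV[R]_n) : compact K ->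
  exists2 r, 0 < r & K `<=` cube (0 - const_mx r) (2 * r).
Proof.
move=> /compact_bounded[M [_ KM]]; exists (`|M| + 1); first by rewrite ltr_wpDl.
move=> x Kx; apply/cube_center; first by rewrite addr_ge0.
by rewrite subr0; apply: KM => //; rewrite ltr_pwDr// ler_norm.
Qed.

Lemma compact_measurable_rV (K : set 'rV[R]_n) : compact K ->
  measurable (K : set (rVleb R n)).
Proof.
move=> Kc; rewrite -(setCK K); apply: measurableC; apply: borel_rVleb.
by apply: open_borel; apply: closed_openC; apply: compact_closed Kc; exact: norm_hausdorff.
Qed.

Definition parts_integrable f :=
  cube_integrable (fun x => Re (f x)) /\ cube_integrable (fun x => Im (f x)).

Lemma parts_integrableB f g : parts_integrable f -> parts_integrable g ->
  parts_integrable (f \- g).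
Proof.
move=> [fR fI] [gR gI]; split.
- by under eq_fun do rewrite /= ReB; exact: cube_integrableB.
- by under eq_fun do rewrite /= ImB; exact: cube_integrableB.
Qed.

Lemma locally_integrable_parts f : locally_integrableC f <-> parts_integrable f.
Proof.
split=> [[mRe [mIm fK]]|[[mRe iRe] [mIm iIm]]].
  have mn := measurable_normc mRe mIm.
  have inorm a l : leb.-integrable (cube a l) (EFin \o (fun x : rVleb R n => normc (f x))).
    apply/integrableP; split.
      by apply/measurable_EFinP; exact: measurable_funS mn.
    rewrite (eq_integral (fun x : rVleb R n => (normc (f x))%:E)); first by apply: fK; exact: compact_cube.
    by move=> x _ /=; rewrite ger0_norm// normc_ge0.
  split; split => // a l l0.
  - apply: le_integrable (inorm a l).
    + exact: measurable_cube.
    + by apply/measurable_EFinP; exact: measurable_funS mRe.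
    + by move=> x _; rewrite /= lee_fin [leRHS]ger0_norm ?normc_ge0// Re_le_normc.
  - apply: le_integrable (inorm a l).
    + exact: measurable_cube.
    + by apply/measurable_EFinP; exact: measurable_funS mIm.
    + by move=> x _; rewrite /= lee_fin [leRHS]ger0_norm ?normc_ge0// Im_le_normc.
have mn := measurable_normc mRe mIm.
split=> //; split=> // K Kc; have [r r0 Kr] := compact_in_cube Kc.
have r20 : 0 < 2 * r by rewrite mulr_gt0.
have mE D : measurable_fun D (EFin \o (fun x : rVleb R n => normc (f x))).
  by apply/measurable_EFinP; exact: measurable_funS mn.
apply: (@le_lt_trans _ _ (\int[leb]_(x in cube (0 - const_mx r) (2 * r)) (normc (f x))%:E)%E).
  apply: ge0_subset_integral.
  - exact: compact_measurable_rV.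
  - exact: measurable_cube.
  - exact: mE.
  - by move=> x _; rewrite lee_fin normc_ge0.
  - exact: Kr.
have := integrableD (measurable_cube (0 - const_mx r) (2 * r))
  (integrable_abse (iRe _ _ r20)) (integrable_abse (iIm _ _ r20)).
move=> /integrableP[mS]; apply: le_lt_trans.
apply: ge0_le_integral.
- exact: measurable_cube.
- by move=> x _; rewrite lee_fin normc_ge0.
- exact: mE.
- by apply: measurableT_comp mS.
- by move=> x _; rewrite /= lee_fin [leRHS]ger0_norm ?addr_ge0// normc_le_ReIm.
Qed.

Lemma mean_parts f a l : 0 < l ->
  mean (cube a l) f = Complex (avg (fun x => Re (f x)) a l) (avg (fun x => Im (f x)) a l).
Proof.
move=> l0; rewrite /mean volume_cube ?ltW// avg.unlock /integralC.
by apply/eqP; rewrite eq_complex /= !mul0r subr0 addr0 !eqxx.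
Qed.

Lemma volume_weight alpha a l : (0 < n)%N -> 0 < l ->
  volume (cube a l) `^ (1 + alpha / n%:R) = l ^+ n * l `^ alpha.
Proof.
move=> n0 l0; have ln : 0 < l ^+ n by rewrite exprn_gt0.
rewrite volume_cube ?ltW// powRD; last by apply/implyP => _; rewrite gt_eqF.
rewrite powRr1 ?ltW//; congr (_ * _).
rewrite -powR_mulrn ?ltW// -powRrM mulrCA mulfV ?mulr1//.
by rewrite pnatr_eq0 -lt0n.
Qed.

Section oscillation_parts.
Variables (alpha : R) (f : 'rV[R]_n -> R[i]).
Hypotheses (n0 : (0 < n)%N) (fI : parts_integrable f).
Local Notation u := (fun x => Re (f x)).
Local Notation v := (fun x => Im (f x)).

Let oscillationE a l : 0 < l -> oscillation alpha f (cube a l) =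
  ((l `^ alpha)^-1%:E * ((l ^+ n)^-1%:E *
    \int[leb]_(x in cube a l) (normc (f x - mean (cube a l) f))%:E))%E.
Proof.
move=> l0; rewrite /oscillation volume_weight// invfM EFinM muleA.
by rewrite [((l `^ alpha)^-1%:E * _)%E]muleC.
Qed.

Let measurable_dev a l :
  measurable_fun [set: rVleb R n] (fun x => normc (f x - mean (cube a l) f)).
Proof.
apply: measurable_normc.
- under eq_fun do rewrite ReB; apply: measurable_funB; first exact: fI.1.1.
  exact: measurable_cst.
- under eq_fun do rewrite ImB; apply: measurable_funB; first exact: fI.2.1.
  exact: measurable_cst.
Qed.

Let integral_avg (h : 'rV[R]_n -> R) a l : 0 < l -> cube_integrable h ->
  ((l ^+ n)^-1%:E * \int[leb]_(x in cube a l) (h x)%:E)%E = (avg h a l)%:E.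
Proof.
move=> l0 hI; rewrite avg.unlock /Rintegral EFinM fineK//.
by apply: integrable_fin_num; [exact: measurable_cube|exact: hI.2].
Qed.

Lemma Re_le_oscillation a l : 0 < l ->
  ((mean_osc u a l / l `^ alpha)%:E <= oscillation alpha f (cube a l))%E.
Proof.
move=> l0; have dI := cube_integrable_dev (avg u a l) fI.1.
rewrite oscillationE// mulrC EFinM /mean_osc -integral_avg//.
have ln : 0 <= (l ^+ n)^-1 by rewrite invr_ge0 exprn_ge0// ltW.
apply: lee_wpmul2l; first by rewrite lee_fin invr_ge0 powR_ge0.
apply: lee_wpmul2l; first by rewrite lee_fin.
apply: ge0_le_integral; first exact: measurable_cube.
- by move=> x _; rewrite lee_fin.
- by apply/measurable_EFinP; exact: measurable_funS dI.1.
- by apply/measurable_EFinP; exact: measurable_funS (measurable_dev a l).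
- move=> x _; rewrite lee_fin; apply: le_trans (Re_le_normc _).
  by rewrite ReB mean_parts.
Qed.

Lemma Im_le_oscillation a l : 0 < l ->
  ((mean_osc v a l / l `^ alpha)%:E <= oscillation alpha f (cube a l))%E.
Proof.
move=> l0; have dI := cube_integrable_dev (avg v a l) fI.2.
rewrite oscillationE// mulrC EFinM /mean_osc -integral_avg//.
have ln : 0 <= (l ^+ n)^-1 by rewrite invr_ge0 exprn_ge0// ltW.
apply: lee_wpmul2l; first by rewrite lee_fin invr_ge0 powR_ge0.
apply: lee_wpmul2l; first by rewrite lee_fin.
apply: ge0_le_integral; first exact: measurable_cube.
- by move=> x _; rewrite lee_fin.
- by apply/measurable_EFinP; exact: measurable_funS dI.1.
- by apply/measurable_EFinP; exact: measurable_funS (measurable_dev a l).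
- move=> x _; rewrite lee_fin; apply: le_trans (Im_le_normc _).
  by rewrite ImB mean_parts.
Qed.

Lemma oscillation_le a l : 0 < l -> (oscillation alpha f (cube a l) <=
  ((mean_osc u a l + mean_osc v a l) / l `^ alpha)%:E)%E.
Proof.
move=> l0; have uI := cube_integrable_dev (avg u a l) fI.1.
have vI := cube_integrable_dev (avg v a l) fI.2.
have sI := cube_integrableD uI vI.
rewrite oscillationE// mulrC EFinM /mean_osc -(avgD a l0 uI vI) -integral_avg//.
have ln : 0 <= (l ^+ n)^-1 by rewrite invr_ge0 exprn_ge0// ltW.
apply: lee_wpmul2l; first by rewrite lee_fin invr_ge0 powR_ge0.
apply: lee_wpmul2l; first by rewrite lee_fin.
apply: ge0_le_integral; first exact: measurable_cube.
- by move=> x _; rewrite lee_fin normc_ge0.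
- by apply/measurable_EFinP; exact: measurable_funS (measurable_dev a l).
- by apply/measurable_EFinP; exact: measurable_funS sI.1.
- by move=> x _; rewrite lee_fin; apply: le_trans (normc_le_ReIm _) _;
    rewrite ReB ImB mean_parts.
Qed.

Lemma oscillation_ge0 a l : 0 < l -> (0 <= oscillation alpha f (cube a l))%E.
Proof.
move=> l0; apply: le_trans (Re_le_oscillation a l0).
by rewrite lee_fin divr_ge0 ?powR_ge0 ?mean_osc_ge0.
Qed.

Lemma oscillation_leP a l e : 0 < l ->
  mean_osc u a l <= e / 2 * l `^ alpha -> mean_osc v a l <= e / 2 * l `^ alpha ->
  (oscillation alpha f (cube a l) <= e%:E)%E.
Proof.
move=> l0 hu hv; apply: le_trans (oscillation_le a l0) _.
by rewrite lee_fin ler_pdivrMr ?powR_gt0//; lra.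
Qed.

Lemma mean_osc_Re_le a l e : 0 < l -> (oscillation alpha f (cube a l) <= e%:E)%E ->
  mean_osc u a l <= e * l `^ alpha.
Proof.
move=> l0 /(le_trans (Re_le_oscillation a l0)).
by rewrite lee_fin ler_pdivrMr ?powR_gt0.
Qed.

Lemma mean_osc_Im_le a l e : 0 < l -> (oscillation alpha f (cube a l) <= e%:E)%E ->
  mean_osc v a l <= e * l `^ alpha.
Proof.
move=> l0 /(le_trans (Im_le_oscillation a l0)).
by rewrite lee_fin ler_pdivrMr ?powR_gt0.
Qed.

Lemma BMO_norm_leP e :
  (forall a l, 0 < l -> mean_osc u a l <= e / 2 * l `^ alpha) ->
  (forall a l, 0 < l -> mean_osc v a l <= e / 2 * l `^ alpha) ->
  (BMO_norm alpha f <= e%:E)%E.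
Proof.
move=> hu hv; apply: ge_ereal_sup => _ [_ [a [l [l0 ->]]] <-].
by apply: oscillation_leP => //; [exact: hu|exact: hv].
Qed.

Lemma oscillation_le_BMO a l : 0 < l ->
  (oscillation alpha f (cube a l) <= BMO_norm alpha f)%E.
Proof.
by move=> l0; apply: ereal_sup_ubound; exists (cube a l) => //; exists a, l.
Qed.

End oscillation_parts.

End complex_parts.

(** * Limits of suprema over families of cubes *)

Section sup_limit.
Variables (R : realType) (T : Type) (G : set_system R) (P : R -> set T) (o : T -> \bar R).
Context {FG : Filter G}.
Hypothesis o_ge0 : forall r q, P r q -> (0 <= o q)%E.

(** Nonemptiness matters because the supremum of the empty set is [-oo], which would prevent
    convergence to 0. *)
Lemma ereal_sup_cvg0 : (\forall r \near G, P r !=set0) ->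
  (forall e : R, 0 < e -> \forall r \near G, forall q, P r q -> (o q <= e%:E)%E) ->
  ereal_sup [set o q | q in P r] @[r --> G] --> 0%E.
Proof.
move=> P0 Pe A nA.
have /nbhs_ballP[e /= e0 eA] : nbhs (0 : R) (fun r => A r%:E) by exact: nA.
have e20 : 0 < e / 2 by rewrite divr_gt0.
rewrite /nbhs /=.
apply: filterS2 P0 (Pe _ e20) => r [q Pq] oe /=.
have s0 : (0 <= ereal_sup [set o q | q in P r])%E.
  by apply: le_trans (o_ge0 Pq) _; apply: ereal_sup_ubound; exists q.
have se : (ereal_sup [set o q | q in P r] <= (e / 2)%:E)%E.
  by apply: ge_ereal_sup => _ [q' Pq' <-]; exact: oe.
case: (ereal_sup _) s0 se => [s| |//]; rewrite ?lee_fin // => s0 se.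
by apply: eA; rewrite /ball /= sub0r normrN ger0_norm//; lra.
Qed.

Lemma ereal_sup_cvg0_near :
  ereal_sup [set o q | q in P r] @[r --> G] --> 0%E ->
  forall e : R, 0 < e -> \forall r \near G, forall q, P r q -> (o q <= e%:E)%E.
Proof.
move=> cv e e0.
have : nbhs (0 : \bar R) [set x | (x < e%:E)%E].
  suff : nbhs (0 : R) (fun s => (s%:E < e%:E)%E) by exact.
  apply/nbhs_ballP; exists e => //= s.
  by rewrite /ball /= sub0r normrN lte_fin => /(le_lt_trans (ler_norm _)).
move=> h; have {}h : G (fun r => (ereal_sup [set o q | q in P r] < e%:E)%E) := cv _ h.
apply: filterS h => r sr q Pq.
by apply: le_trans (ltW sr); apply: ereal_sup_ubound; exists q.
Qed.

End sup_limit.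

Section limits.
Variables (R : realType) (n : nat) (alpha : R) (f : 'rV[R]_n -> R[i]).
Hypotheses (n0 : (0 < n)%N) (fI : parts_integrable f).
Local Notation leb := (@lebesgue_rV R n).
Local Notation u := (fun x => complex.Re (f x)).
Local Notation v := (fun x => complex.Im (f x)).

Implicit Types (l d r e : R) (a x : 'rV[R]_n).

Let osc_ge0 Q : is_cube Q -> (0 <= oscillation alpha f Q)%E.
Proof. by move=> [a [l [l0 ->]]]; exact: oscillation_ge0. Qed.

Let lt_side l d : 0 < l -> 0 <= d -> l ^+ n < d ^+ n -> l < d.
Proof.
move=> l0 d0; rewrite ltNge => /negP h; rewrite ltNge; apply/negP => dl; apply: h.
by apply: lerXn2r; rewrite ?nnegrE// ltW.
Qed.

Let volume_cubes_neq0 r : 0 < r ->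
  [set Q : set 'rV[R]_n | is_cube Q /\ leb Q = r%:E] !=set0.
Proof.
move=> r0; pose l := r `^ n%:R^-1; have l0 : 0 < l by exact: powR_gt0.
exists (cube 0 l); split; first by exists 0, l.
rewrite lebesgue_cube ?ltW//; congr _%:E.
rewrite -powR_mulrn ?ltW// -powRrM mulVf ?powRr1 ?ltW//.
by rewrite pnatr_eq0 -lt0n.
Qed.

Lemma vanishing_small_limit :
  ereal_sup [set oscillation alpha f Q
    | Q in [set Q | is_cube Q /\ leb Q = r%:E]] @[r --> 0^'+] --> 0%E <->
  vanishing_small alpha u /\ vanishing_small alpha v.
Proof.
split=> [cv|[hu hv]].
  have H e : 0 < e -> exists2 d, 0 < d & forall a l, 0 < l -> l < d ->
      (oscillation alpha f (cube a l) <= e%:E)%E.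
    move=> e0; have [d /= d0 H] := ereal_sup_cvg0_near cv e0.
    (* The filter controls the volume [l ^+ n] and not the side; [l < 1] gives [l ^+ n <= l < d]. *)
    exists (Num.min 1 d) => [|a l l0]; first by rewrite lt_min ltr01.
    rewrite lt_min => /andP[l1 ld]; have ln : 0 < l ^+ n by rewrite exprn_gt0.
    apply: (H (l ^+ n)) => //.
      rewrite /ball /= sub0r normrN gtr0_norm//; apply: le_lt_trans ld.
      by rewrite ler_iXnr// ltW.
    by split; [exists a, l|rewrite lebesgue_cube// ltW].
  split=> e /H[d d0 hd]; exists d => // a l l0 ld.
    by apply: mean_osc_Re_le => //; exact: hd.
  by apply: mean_osc_Im_le => //; exact: hd.
apply: ereal_sup_cvg0.
- by move=> r Q [Qc _]; exact: osc_ge0.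
- by apply: filterS (nbhs_right_gt 0) => r; exact: volume_cubes_neq0.
move=> e e0; have e20 : 0 < e / 2 by rewrite divr_gt0.
have [d1 d10 hd1] := hu _ e20; have [d2 d20 hd2] := hv _ e20.
pose d := Num.min d1 d2; have d0 : 0 < d by rewrite lt_min d10.
apply: filterS (nbhs_right_lt (exprn_gt0 n d0)) => r rd _ [[a [l [l0 ->]]]].
rewrite lebesgue_cube ?(ltW l0)// => -[lr].
have : l < d by apply: lt_side; rewrite ?(ltW d0)// lr.
rewrite lt_min => /andP[ld1 ld2].
by apply: oscillation_leP => //; [exact: hd1|exact: hd2].
Qed.

Lemma vanishing_large_limit :
  ereal_sup [set oscillation alpha f Q
    | Q in [set Q | is_cube Q /\ leb Q = r%:E]] @[r --> +oo] --> 0%E <->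
  vanishing_large alpha u /\ vanishing_large alpha v.
Proof.
split=> [cv|[hu hv]].
  have H e : 0 < e -> exists d, forall a l, 0 < l -> d < l ->
      (oscillation alpha f (cube a l) <= e%:E)%E.
    move=> e0; have [d /= [_ H]] := ereal_sup_cvg0_near cv e0.
    exists (`|d| + 1) => a l l0 dl; apply: (H (l ^+ n)).
      apply: (@lt_le_trans _ _ l); first by have := ler_norm d; lra.
      by rewrite ler_eXnr//; have := normr_ge0 d; lra.
    by split; [exists a, l|rewrite lebesgue_cube// ltW].
  split=> e /H[d hd]; exists d => a l l0 ld.
    by apply: mean_osc_Re_le => //; exact: hd.
  by apply: mean_osc_Im_le => //; exact: hd.
apply: ereal_sup_cvg0.
- by move=> r Q [Qc _]; exact: osc_ge0.
- by apply: filterS (nbhs_pinfty_gt (num_real 0)) => r; exact: volume_cubes_neq0.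
move=> e e0; have e20 : 0 < e / 2 by rewrite divr_gt0.
have [d1 hd1] := hu _ e20; have [d2 hd2] := hv _ e20.
pose d := `|d1| + `|d2|; have d0 : 0 <= d by rewrite addr_ge0.
apply: filterS (nbhs_pinfty_gt (num_real (d ^+ n))) => r rd _ [[a [l [l0 ->]]]].
rewrite lebesgue_cube ?(ltW l0)// => -[lr].
have dl : d < l.
  rewrite ltNge; apply/negP => ld; move: rd; rewrite ltNge => /negP; apply.
  by rewrite -lr; apply: lerXn2r; rewrite ?nnegrE// ltW.
have ld1 : d1 < l by apply: le_lt_trans dl; rewrite /d (le_trans (ler_norm _))// lerDl.
have ld2 : d2 < l by apply: le_lt_trans dl; rewrite /d (le_trans (ler_norm _))// lerDr.
by apply: oscillation_leP => //; [exact: hd1|exact: hd2].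
Qed.

Let box_norm d x : 0 <= d -> (forall i, - d <= x ord0 i <= d) <-> `|x : 'rV[R]_n| <= d.
Proof.
move=> d0; split=> [xd|xd i].
  by apply: normrV_le => // i; rewrite ler_norml.
by rewrite -ler_norml (le_trans (normrV_coord x i)).
Qed.

Let disjoint_box (Q : set 'rV[R]_n) d : 0 <= d ->
  Q `&` [set x | forall i, - d <= x ord0 i <= d] = set0 <->
  forall x, Q x -> d < `|x|.
Proof.
move=> d0; split=> [Q0 x Qx|Qd].
  rewrite ltNge; apply/negP => /(box_norm _ d0) xd.
  by have : set0 x by rewrite -Q0.
by apply/seteqP; split=> x // [/Qd + /(box_norm _ d0)]; rewrite leNgt => ->.
Qed.

Lemma vanishing_far_limit :
  ereal_sup [set oscillation alpha f Q
    | Q in [set Q | is_cube Q /\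
        Q `&` [set x | forall i, - d <= x ord0 i <= d] = set0]] @[d --> +oo] --> 0%E <->
  vanishing_far alpha u /\ vanishing_far alpha v.
Proof.
split=> [cv|[hu hv]].
  have H e : 0 < e -> exists d, forall a l, 0 < l -> (forall x, cube a l x -> d < `|x|) ->
      (oscillation alpha f (cube a l) <= e%:E)%E.
    move=> e0; have [d /= [_ H]] := ereal_sup_cvg0_near cv e0.
    exists (`|d| + 1) => a l l0 dl; apply: (H (`|d| + 1)).
      by rewrite ltr_pwDr// ler_norm.
    by split; [exists a, l|apply/disjoint_box => //; rewrite addr_ge0].
  split=> e /H[d hd]; exists d => a l l0 ld.
    by apply: mean_osc_Re_le => //; exact: hd.
  by apply: mean_osc_Im_le => //; exact: hd.
apply: ereal_sup_cvg0.
- by move=> r Q [Qc _]; exact: osc_ge0.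
- apply: filterS (nbhs_pinfty_gt (num_real 0)) => d d0.
  exists (cube (const_mx (d + 1)) 1); split; first by exists (const_mx (d + 1)), 1.
  apply/disjoint_box => [|x xd]; first exact: ltW.
  have := xd (Ordinal n0); rewrite mxE => /andP[x1 _].
  apply: lt_le_trans (normrV_coord x (Ordinal n0)); apply: lt_le_trans (ler_norm _).
  by apply: lt_le_trans x1; rewrite ltrDl.
move=> e e0; have e20 : 0 < e / 2 by rewrite divr_gt0.
have [d1 hd1] := hu _ e20; have [d2 hd2] := hv _ e20.
pose d := `|d1| + `|d2|; have d0 : 0 <= d by rewrite addr_ge0.
apply: filterS (nbhs_pinfty_gt (num_real d)) => r rd _ [[a [l [l0 ->]]]].
move=> /disjoint_box - /(_ (ltW (le_lt_trans d0 rd))) far.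
apply: oscillation_leP => //.
- apply: hd1 => // x /far; apply: le_lt_trans; apply: le_trans (ler_norm _) _.
  by apply: le_trans (ltW rd); rewrite lerDl.
- apply: hd2 => // x /far; apply: le_lt_trans; apply: le_trans (ler_norm _) _.
  by apply: le_trans (ltW rd); rewrite lerDr.
Qed.

End limits.

(** * Vanishing oscillation and almost everywhere constant functions *)

Section almost_constant.
Variables (R : realType) (n : nat).
Local Notation leb := (@lebesgue_rV R n).
Implicit Types (u : 'rV[R]_n -> R) (a : 'rV[R]_n) (l : R).

Lemma lebesgue_rV_complete : measure_is_complete leb.
Proof. exact: measure_is_complete_caratheodory. Qed.

Lemma ae_imp (P Q : 'rV[R]_n -> Prop) : (forall x, P x -> Q x) ->
  {ae leb, forall x, P x} -> {ae leb, forall x, Q x}.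
Proof. by move=> PQ; apply: negligibleS => x /= nQ /PQ. Qed.

(** Nested cubes have equal means when the oscillation vanishes, so one constant serves a sequence
    of cubes that exhausts the space, and countably many null sets are discarded. *)
Lemma mean_osc0_ae u : cube_integrable u ->
  (forall a l, 0 < l -> mean_osc u a l = 0) ->
  exists c, {ae leb, forall x, u x = c}.
Proof.
move=> uI u0.
pose Q (k : nat) : 'rV[R]_n := 0 - const_mx k.+1%:R.
pose s (k : nat) : R := 2 * k.+1%:R.
have s0 k : 0 < s k by rewrite mulr_gt0.
pose c := avg u (Q 0%N) (s 0%N).
have sub k : cube (Q 0%N) (s 0%N) `<=` cube (Q k) (s k).
  move=> x /cube_center x1; apply/cube_center; first exact: ler0n.
  by apply: le_trans (x1 _) _; rewrite ?ler_nat.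
have avgc k : avg u (Q k) (s k) = c.
  have := avg_sub_le (s0 0%N) (s0 k) uI (sub k); rewrite u0// mulr0 normr_le0 subr_eq0.
  by move=> /eqP.
exists c.
have negl k : leb.-negligible [set x | cube (Q k) (s k) x /\ u x <> c].
  have dI := cube_integrable_dev c uI.
  have uB : measurable_fun (cube (Q k) (s k) : set (rVleb R n)) (EFin \o (fun x : rVleb R n => u x - c)).
    have m : measurable_fun [set: rVleb R n] (fun x => u x - c).
      by apply: measurable_funB; [exact: uI.1|exact: measurable_cst].
    by apply/measurable_EFinP; exact: measurable_funS m.
  have : (\int[leb]_(x in cube (Q k) (s k)) `|(EFin \o (fun x : rVleb R n => u x - c)%R) x| = 0)%E.
    have := u0 (Q k) (s k) (s0 k); rewrite /mean_osc avgc avg.unlock => /eqP.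
    rewrite mulf_eq0 invr_eq0 gt_eqF ?exprn_gt0//= => /eqP h.
    rewrite -[LHS]fineK; first by congr _%:E; exact: h.
    by apply: integrable_fin_num; [exact: measurable_cube|exact: dI.2].
  move=> /(ae_eq_integral_abs leb (measurable_cube _ _) uB).
  apply: negligibleS => x [xQ uxc] /= /(_ xQ) []; move/eqP; rewrite subr_eq0 => /eqP.
  exact: uxc.
apply: negligibleS (negligible_bigcup negl) => x /= uxc.
exists (Num.truncn `|x|) => //; split => //.
apply/cube_center; first exact: ler0n.
by rewrite subr0; exact/ltW/truncnS_gt.
Qed.

Section ae_equal.
Variables (u : 'rV[R]_n -> R) (c : R).
Hypothesis uc : {ae leb, forall x, u x = c}.

(** This rests on the completeness of the measure: a function equal to a constant off a null set
    need not be Borel. *)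
Lemma ae_constant_measurable : measurable_fun [set: rVleb R n] u.
Proof.
apply/measurable_EFinP.
apply: (ae_measurable_fun lebesgue_rV_complete (f := cst c%:E)) => //.
by apply: ae_imp uc => x /= ->.
Qed.

Lemma ae_constant_integrable : cube_integrable u.
Proof.
have mu := ae_constant_measurable; split=> // a l l0.
have mD : measurable_fun (cube a l : set (rVleb R n)) (EFin \o (u : rVleb R n -> R)).
  by apply/measurable_EFinP; exact: measurable_funS mu.
apply/integrableP; split => //.
have [_ ci] := cube_integrable_cst n c; have /integrableP[_] := ci a l l0.
apply: le_lt_trans; apply: ae_ge0_le_integral.
- exact: measurable_cube.
- by [].
- by apply: measurableT_comp mD.
- by [].
- exact: measurable_cst.
- by apply: ae_imp uc => x /= -> _.
Qed.

Lemma ae_constant_mean_osc a l : 0 < l -> mean_osc u a l = 0.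
Proof.
move=> l0; have mu := ae_constant_measurable.
have avgE (h : 'rV[R]_n -> R) d : measurable_fun [set: rVleb R n] h ->
    {ae leb, forall x, h x = d} -> avg h a l = d.
  move=> mh hd; rewrite -[RHS](avg_cst d a l0) avg.unlock /Rintegral; congr (_ * fine _).
  apply: ae_eq_integral; first exact: measurable_cube.
  - by apply/measurable_EFinP; exact: measurable_funS mh.
  - exact: measurable_cst.
  - by apply: ae_imp hd => x /= ->.
have au := avgE u c mu uc; rewrite /mean_osc; apply: avgE.
  apply: measurableT_comp; first exact: normr_measurable.
  by apply: measurable_funB => //; exact: measurable_cst.
rewrite au; apply: ae_imp uc => x /= ->.
by rewrite subrr normr0.
Qed.

End ae_equal.

Lemma ae_const_uniq (T : Type) (f : 'rV[R]_n -> T) (c d : T) :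
  {ae leb, forall x, f x = c} -> {ae leb, forall x, f x = d} -> c = d.
Proof.
move=> fc fd; apply: contrapT => cd.
have : leb.-negligible [set: rVleb R n].
  apply: negligibleS (negligibleU fc fd) => x _ /=.
  apply: contrapT => /not_orP[/contrapT h1 /contrapT h2]; apply: cd.
  by rewrite -h1 h2.
move=> h; have := measure_negligible (measurable_cube 0 1)
  (negligibleS (B := cube 0 1 : set (rVleb R n)) (@subsetT _ _) h).
by rewrite [LHS]lebesgue_cube// expr1n => -[] /eqP; rewrite oner_eq0.
Qed.

End almost_constant.

(** * Comparison of the two spaces *)

Section spaces.
Variables (R : realType) (n : nat).
Hypothesis n0 : (0 < n)%N.
Local Notation Re := complex.Re.
Local Notation Im := complex.Im.
Local Notation leb := (@lebesgue_rV R n).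
Implicit Types (f g : 'rV[R]_n -> R[i]) (u G : 'rV[R]_n -> R) (alpha : R).

Lemma Cc_infty_out g : Cc_infty g -> exists2 T, 0 < T & forall x, T < `|x| -> g x = 0.
Proof.
move=> [_ [_ /compact_in_cube[r r0 gr]]]; exists r => // x rx.
apply/eqP/negPn/negP => gx; have /gr/cube_center : closure [set x | g x != 0] x.
  exact: subset_closure.
by move=> /(_ (ltW r0)); rewrite subr0 leNgt rx.
Qed.

Lemma Cc_infty_Complex G1 G2 T : smooth G1 -> smooth G2 ->
  (forall x, T < `|x| -> G1 x = 0) -> (forall x, T < `|x| -> G2 x = 0) ->
  Cc_infty (fun x => Complex (G1 x) (G2 x)).
Proof.
move=> sG1 sG2 G1T G2T; split; [exact: sG1|split; [exact: sG2|]].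
have cB : compact (cube (0 - const_mx `|T| : 'rV[R]_n) (2 * `|T|)) by exact: compact_cube.
have clB := compact_closed (@norm_hausdorff _ _) cB.
apply: (subclosed_compact _ cB); first exact: closed_closure.
rewrite [X in _ `<=` X](proj1 (closure_id _) clB); apply: closureS => x /= gx.
apply/cube_center; first exact: normr_ge0.
rewrite subr0; apply: le_trans (ler_norm T); rewrite leNgt; apply: contra gx => Tx.
by rewrite G1T// G2T.
Qed.

Lemma CMOP alpha f : CMO n alpha f <->
  [/\ BMO alpha f,
    vanishing_small alpha (fun x => Re (f x)) /\ vanishing_small alpha (fun x => Im (f x)),
    vanishing_large alpha (fun x => Re (f x)) /\ vanishing_large alpha (fun x => Im (f x)) &
    vanishing_far alpha (fun x => Re (f x)) /\ vanishing_far alpha (fun x => Im (f x))].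
Proof.
split=> [[fB [c1 c2 c3]]|[fB c1 c2 c3]].
  have fI := (locally_integrable_parts f).1 fB.1.
  split=> //.
  - exact: (vanishing_small_limit alpha n0 fI).1.
  - exact: (vanishing_large_limit alpha n0 fI).1.
  - exact: (vanishing_far_limit alpha n0 fI).1.
have fI := (locally_integrable_parts f).1 fB.1.
split=> //; split.
- exact: (vanishing_small_limit alpha n0 fI).2.
- exact: (vanishing_large_limit alpha n0 fI).2.
- exact: (vanishing_far_limit alpha n0 fI).2.
Qed.

(** [V] stands for any of the three vanishing conditions, so that the passage from [f] to its parts
    is made once. *)
Definition approximable alpha (V : ('rV[R]_n -> R) -> Prop) u := forall e, 0 < e ->
  exists G, [/\ cube_integrable G, V G &
    forall a l, 0 < l -> mean_osc (fun x => u x - G x) a l <= e * l `^ alpha].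

Lemma mean_osc_approx u G e1 e2 w a l : 0 < l -> cube_integrable u -> cube_integrable G ->
  mean_osc (fun x => u x - G x) a l <= e1 * w -> mean_osc G a l <= e2 * w ->
  mean_osc u a l <= (e1 + e2) * w.
Proof.
move=> l0 uI GI h1 h2; rewrite (@eq_mean_osc _ _ _ (fun x => (u x - G x) + G x)).
  apply: le_trans (mean_oscD a l0 (cube_integrableB uI GI) GI) _.
  by rewrite mulrDl lerD.
by move=> x _; rewrite subrK.
Qed.

Lemma approximable_small alpha u : cube_integrable u ->
  approximable alpha (vanishing_small alpha) u -> vanishing_small alpha u.
Proof.
move=> uI ap e e0; have e20 : 0 < e / 2 by rewrite divr_gt0.
have [G [GI GV uG]] := ap _ e20; have [d d0 hd] := GV _ e20.
exists d => // a l l0 ld; rewrite [e]splitr.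
by apply: (mean_osc_approx l0 uI GI (uG a l l0)); exact: hd.
Qed.

Lemma approximable_large alpha u : cube_integrable u ->
  approximable alpha (vanishing_large alpha) u -> vanishing_large alpha u.
Proof.
move=> uI ap e e0; have e20 : 0 < e / 2 by rewrite divr_gt0.
have [G [GI GV uG]] := ap _ e20; have [d hd] := GV _ e20.
exists d => a l l0 ld; rewrite [e]splitr.
by apply: (mean_osc_approx l0 uI GI (uG a l l0)); exact: hd.
Qed.

Lemma approximable_far alpha u : cube_integrable u ->
  approximable alpha (vanishing_far alpha) u -> vanishing_far alpha u.
Proof.
move=> uI ap e e0; have e20 : 0 < e / 2 by rewrite divr_gt0.
have [G [GI GV uG]] := ap _ e20; have [d hd] := GV _ e20.
exists d => a l l0 ld; rewrite [e]splitr.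
by apply: (mean_osc_approx l0 uI GI (uG a l l0)); exact: hd.
Qed.

Lemma Cc_infty_parts_integrable g : Cc_infty g -> parts_integrable g.
Proof.
move=> gC; have [T T0 gT] := Cc_infty_out gC; case: gC => sR [sI _]; split.
- by apply: (cube_integrable_smooth sR T0) => x /gT ->.
- by apply: (cube_integrable_smooth sI T0) => x /gT ->.
Qed.

Lemma CMO_closure_close alpha f e : CMO_closure n alpha f -> 0 < e ->
  exists2 g, Cc_infty g & forall a l, 0 < l ->
    mean_osc (fun x => Re (f x) - Re (g x)) a l <= e * l `^ alpha /\
    mean_osc (fun x => Im (f x) - Im (g x)) a l <= e * l `^ alpha.
Proof.
move=> [[/locally_integrable_parts fI _] fcl] e0; have [g [gC fg]] := fcl e e0.
have fgI := parts_integrableB fI (Cc_infty_parts_integrable gC).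
exists g => // a l l0.
have osc := le_trans (oscillation_le_BMO alpha (f \- g) a l0) (ltW fg).
have := mean_osc_Re_le n0 fgI l0 osc; have := mean_osc_Im_le n0 fgI l0 osc.
rewrite (@eq_mean_osc _ _ _ (fun x => Im (f x) - Im (g x))); last by move=> x _; exact: ImB.
rewrite (@eq_mean_osc _ _ (fun x => Re _) (fun x => Re (f x) - Re (g x))) //.
by move=> x _; exact: ReB.
Qed.

Lemma CMO_closure_sub alpha : 0 <= alpha < 1 -> CMO_closure n alpha `<=` CMO n alpha.
Proof.
move=> /andP[al0 al1] f fcl; have fB := fcl.1.
have [fR fI] := (locally_integrable_parts f).1 fB.1.
have approx V : (forall G T, smooth G -> 0 < T -> (forall x, T < `|x| -> G x = 0) -> V G) ->
    approximable alpha V (fun x => Re (f x)) /\ approximable alpha V (fun x => Im (f x)).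
  move=> VP; split=> e e0; have [g gC hg] := CMO_closure_close fcl e0;
    have [gR gI] := Cc_infty_parts_integrable gC; have [T T0 gT] := Cc_infty_out gC.
    exists (fun x => Re (g x)); split; [exact: gR| |by move=> a l l0; case: (hg a l l0)].
    by apply: (VP _ T gC.1 T0) => x /gT ->.
  exists (fun x => Im (g x)); split; [exact: gI| |by move=> a l l0; case: (hg a l l0)].
  by apply: (VP _ T gC.2.1 T0) => x /gT ->.
have [sR sI] := approx _ (fun G T sG T0 GT => smooth_vanishing_small sG T0 GT al1).
have [lR lI] := approx _ (fun G T sG T0 GT => smooth_vanishing_large sG T0 GT n0 al0).
have [aR aI] := approx _ (fun G T _ _ GT => @smooth_vanishing_far _ _ alpha T G GT).
apply/CMOP; split=> //; split.
- exact: approximable_small.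
- exact: approximable_small.
- exact: approximable_large.
- exact: approximable_large.
- exact: approximable_far.
- exact: approximable_far.
Qed.

Lemma BMO_normB_leP alpha f g e : parts_integrable f -> parts_integrable g ->
  (forall a l, 0 < l -> mean_osc (fun x => Re (f x) - Re (g x)) a l <= e / 2 * l `^ alpha) ->
  (forall a l, 0 < l -> mean_osc (fun x => Im (f x) - Im (g x)) a l <= e / 2 * l `^ alpha) ->
  (BMO_norm alpha (f \- g)%R <= e%:E)%E.
Proof.
move=> fI gI hR hI; apply: (BMO_norm_leP n0 (parts_integrableB fI gI)) => a l l0.
  by rewrite (@eq_mean_osc _ _ _ (fun x => Re (f x) - Re (g x))); [exact: hR|move=> x _; exact: ReB].
by rewrite (@eq_mean_osc _ _ _ (fun x => Im (f x) - Im (g x))); [exact: hI|move=> x _; exact: ImB].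
Qed.

Lemma CMO_sub_closure alpha : 0 <= alpha < 1 -> CMO n alpha `<=` CMO_closure n alpha.
Proof.
move=> al01 f /CMOP[fB [sR sI] [lR lI] [aR aI]].
have fI := (locally_integrable_parts f).1 fB.1.
(* One halving shares the error between real and imaginary parts, the other makes the final
   inequality strict. *)
split=> // e e0; have e4 : 0 < e / 2 / 2 by rewrite !divr_gt0.
have [G1 [sG1 [T1 G1T] h1]] := smooth_approximation al01 fI.1 sR lR aR e4.
have [G2 [sG2 [T2 G2T] h2]] := smooth_approximation al01 fI.2 sI lI aI e4.
have gC : Cc_infty (fun x => Complex (G1 x) (G2 x)).
  apply: (@Cc_infty_Complex _ _ (Num.max T1 T2)) => // x; rewrite gt_max => /andP[? ?].
    exact: G1T.
  exact: G2T.
exists (fun x => Complex (G1 x) (G2 x)); split=> //.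
apply: (@le_lt_trans _ _ (e / 2)%:E); last by rewrite lte_fin; lra.
exact: BMO_normB_leP (Cc_infty_parts_integrable gC) h1 h2.
Qed.

Lemma CMO1_mean_osc f a l : CMO n 1 f -> 0 < l ->
  mean_osc (fun x => Re (f x)) a l = 0 /\ mean_osc (fun x => Im (f x)) a l = 0.
Proof.
move=> /CMOP[fB [sR sI] _ _] l0; have [fR fI] := (locally_integrable_parts f).1 fB.1.
by split; exact: vanishing_small1.
Qed.

(** All oscillations vanish, so the zero function is already at distance 0. *)
Lemma CMO1_sub_closure : CMO n (1 : R) `<=` CMO_closure n (1 : R).
Proof.
move=> f fC; split=> [|e e0]; first exact: fC.1.
have gC : Cc_infty (fun _ : 'rV[R]_n => Complex 0 0 : R[i]).
  by apply: (@Cc_infty_Complex (fun=> 0) (fun=> 0) 0) => //; exact: smooth0.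
exists (fun=> Complex 0 0); split=> //.
apply: (@le_lt_trans _ _ 0%:E); last by rewrite lte_fin.
have fI := (locally_integrable_parts f).1 fC.1.1.
apply: BMO_normB_leP fI (Cc_infty_parts_integrable gC) _ _ => a l l0.
  rewrite (@eq_mean_osc _ _ _ (fun x => Re (f x))).
    by rewrite (CMO1_mean_osc a fC l0).1 !mul0r.
  by move=> x _; rewrite subr0.
rewrite (@eq_mean_osc _ _ _ (fun x => Im (f x))).
  by rewrite (CMO1_mean_osc a fC l0).2 !mul0r.
by move=> x _; rewrite subr0.
Qed.

Lemma CMO1_ae_constant : CMO n (1 : R) = ae_constant R n.
Proof.
apply/seteqP; split=> f.
  move=> fC; have [fR fI] := (locally_integrable_parts f).1 fC.1.1.
  have [c1 hc1] := mean_osc0_ae fR (fun a l l0 => (CMO1_mean_osc a fC l0).1).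
  have [c2 hc2] := mean_osc0_ae fI (fun a l l0 => (CMO1_mean_osc a fC l0).2).
  have fc : {ae leb, forall x, f x = Complex c1 c2}.
    apply: negligibleS (negligibleU hc1 hc2) => x /= fx.
    apply: contrapT => /not_orP[/contrapT h1 /contrapT h2]; apply: fx.
    by rewrite -h1 -h2; case: (f x).
  exists (Complex c1 c2); split=> // d; exact: ae_const_uniq.
move=> [c [fc _]].
have fR : {ae leb, forall x, Re (f x) = Re c} by apply: ae_imp fc => x ->.
have fI : {ae leb, forall x, Im (f x) = Im c} by apply: ae_imp fc => x ->.
have fP : parts_integrable f by split; [exact: ae_constant_integrable fR|exact: ae_constant_integrable fI].
have oR a l : 0 < l -> mean_osc (fun x => Re (f x)) a l = 0.
  exact: (ae_constant_mean_osc fR).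
have oI a l : 0 < l -> mean_osc (fun x => Im (f x)) a l = 0.
  exact: (ae_constant_mean_osc fI).
apply/CMOP; split.
- split; first exact/locally_integrable_parts.
  apply: (@le_lt_trans _ _ 0%:E); last by rewrite ltry.
  by apply: (BMO_norm_leP n0 fP) => a l l0; rewrite ?oR ?oI// !mul0r.
- split=> e e0; exists 1 => // a l l0 _; rewrite ?oR ?oI//;
    by rewrite mulr_ge0 ?powR_ge0// ltW.
- split=> e e0; exists 0 => a l l0 _; rewrite ?oR ?oI//;
    by rewrite mulr_ge0 ?powR_ge0// ltW.
- split=> e e0; exists 0 => a l l0 _; rewrite ?oR ?oI//;
    by rewrite mulr_ge0 ?powR_ge0// ltW.
Qed.

(** Otherwise all cubes inside one large cube would have the same mean, whereas the tent is at least
    1/2 on a small cube at the origin and 0 on a distant one. *)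
Lemma tent_mean_osc : ~ forall a l, 0 < l -> mean_osc (@tent R n) a l = 0.
Proof.
have [L L0 tL] := tent_lipschitz R n.
have out (x : 'rV[R]_n) : 1 < `|x| -> tent x = 0 by move=> /ltW; exact: tent_out.
have tI := cube_integrable_smooth (@smooth_tent R n) ltr01 out.
have t0 : tent (0 : 'rV[R]_n) = 1.
  by rewrite /tent big1// => j _; rewrite mxE hatE add0r step_ge1// step_le0// subr0.
move=> H.
(* Chosen so that the tent drops by at most [L * l <= 1/2] from its value 1 at the origin; [L + 1]
   avoids a division by zero. *)
pose l := (2 * (L + 1))^-1; have L1 : 0 < L + 1 by rewrite ltr_wpDl.
have l0 : 0 < l by rewrite invr_gt0 mulr_gt0.
have lL : L * l <= 2^-1.
  by rewrite /l invfM mulrCA -[leRHS]mulr1 ler_wpM2l// ler_pdivrMr// mul1r lerDl.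
have l2 : l <= 1.
  by rewrite /l invf_le1 ?mulr_gt0//; lra.
have q8 : (0 : R) < 2 * 4 by rewrite mulr_gt0.
have same a m : 0 < m -> cube a m `<=` cube (0 - const_mx 4) (2 * 4) ->
    avg (@tent R n) a m = avg (@tent R n) (0 - const_mx 4) (2 * 4).
  move=> m0 sub; have := avg_sub_le m0 q8 tI sub.
  by rewrite H// mulr0 normr_le0 subr_eq0 => /eqP.
have near : 2^-1 <= avg (@tent R n) 0 l.
  rewrite -[leLHS](avg_cst (n := n) _ 0 l0); apply: (le_avg l0 (cube_integrable_cst _ _) tI) => x xc.
  have := tL x 0; rewrite t0 subr0 => h.
  have xl := cube_dist (ltW l0) xc (cube_corner 0 (ltW l0)); rewrite subr0 in xl.
  have := ler_wpM2l L0 xl; move: h; rewrite ler_norml => /andP[h _] h'; lra.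
have far : avg (@tent R n) (const_mx 2) 1 = 0.
  rewrite (@eq_avg _ _ _ (fun=> 0)) ?avg_cst// => x xc; apply: tent_out.
  have := xc (Ordinal n0); rewrite mxE => /andP[x1 _].
  apply: le_trans (normrV_coord x (Ordinal n0)); apply: le_trans (ler_norm _); lra.
have : avg (@tent R n) 0 l = avg (@tent R n) (const_mx 2) 1.
  rewrite (same 0 l l0) ?(same (const_mx 2) 1)// => x xc; apply/cube_center => //.
    have := cube_dist ler01 xc (cube_corner (const_mx 2) ler01).
    have c2 : `|const_mx 2 : 'rV[R]_n| <= 2.
      by apply: normrV_le => // i; rewrite mxE ger0_norm.
    have := ler_normD (x - const_mx 2) (const_mx 2); rewrite subrK subr0; lra.
  have := cube_dist (ltW l0) xc (cube_corner 0 (ltW l0)); lra.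
by rewrite far => h; move: near; rewrite h; lra.
Qed.

(** A tent is Lipschitz, so its oscillation is O(l), exactly the weight at [alpha = 1]; being smooth
    with compact support, it approximates itself. *)
Lemma CMO1_proper : CMO n (1 : R) `<` CMO_closure n (1 : R).
Proof.
split; first exact: CMO1_sub_closure.
move=> sub; pose f (x : 'rV[R]_n) := Complex (tent x) 0 : R[i].
have out (x : 'rV[R]_n) : 1 < `|x| -> tent x = 0 by move=> /ltW; exact: tent_out.
have fC : Cc_infty f by apply: (Cc_infty_Complex (@smooth_tent R n) (@smooth0 R n) out).
have fP := Cc_infty_parts_integrable fC.
have [L L0 tL] := mean_osc_smooth (@smooth_tent R n) ltr01 out.
have fB : BMO 1 f.
  split; first exact/locally_integrable_parts.
  apply: (@le_lt_trans _ _ (2 * L)%:E); last by rewrite ltry.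
  have L2 : 2 * L / 2 = L by field.
  apply: (BMO_norm_leP n0 fP) => a l l0; rewrite L2 powRr1 ?(ltW l0)//; first exact: tL.
  rewrite (@eq_mean_osc _ _ _ (fun=> 0)) ?mean_osc_cst//.
  by rewrite mulr_ge0// ltW.
have /sub fCMO : CMO_closure n (1 : R) f.
  split=> // e e0; exists f; split=> //.
  apply: (@le_lt_trans _ _ 0%:E); last by rewrite lte_fin.
  apply: (BMO_normB_leP fP fP) => a l l0;
    by rewrite (@eq_mean_osc _ _ _ (fun=> 0)) ?mean_osc_cst ?mul0r// => x _; rewrite subrr.
by apply: tent_mean_osc => a l l0; exact: (CMO1_mean_osc a fCMO l0).1.
Qed.

End spaces.

Theorem theorem1p7 (R : realType) (n : nat) (n_gt0 : (0 < n)%N) :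
  (forall alpha : R, 0 <= alpha < 1 -> CMO_closure n alpha = CMO n alpha) /\
  CMO n (1 : R) `<` CMO_closure n (1 : R) /\
  CMO n (1 : R) = ae_constant R n.
Proof.
split=> [alpha al01|].
  by apply/seteqP; split; [exact: CMO_closure_sub|exact: CMO_sub_closure].
split; first exact: CMO1_proper.
exact: CMO1_ae_constant.
Qed.
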